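(* Let $\mathcal{D}\subset\mathbb{R}^d$ be compact, $0<a,b<\infty$, $c:=a+b$, $p_Z\in\mathcal{P}_Z$, and let $p_X$ satisfy $\inf_{x\in\mathcal{D}}p_X(x)=\nu>0$. Let $\mathcal{B}=\{\phi_j\}_{j=0}^\infty$ be an orthonormal (Schauder) basis of $\mathbf{L}^2(\mathcal{D})$. For $x\in\mathcal{D}$ let $S_{n,m}(x):=\hat f_{n,m}(x)-f_m(x)$. Suppose there exist a non-negative increasing sequence of reals $\{\Lambda_m\}_{m=1}^\infty$, a non-negative increasing sequence of positive integers $\{m(n)\}_{n=1}^\infty$, and constants $C_1,C_2>0$ such that: (1) for almost every $x,y\in\mathcal{D}$ and all $m$, $\left|\sum_{j=0}^{m-1}\phi_j(x)\phi_j^*(y)\frac{1}{p_X(y)}\right|\le C_1\Lambda_m$; (2) for all $f\in\mathcal{F}$, almost every $x\in\mathcal{D}$ and all $m$, $\left|\sum_{j=0}^{m-1}\langle f,\phi_j\rangle\phi_j(x)\right|\le C_2\Lambda_m$; (3) for all $\epsilon>0$, $\sum_{n=1}^\infty\exp\left(\frac{-\epsilon^2 n}{\Lambda_{m(n)}^2}\right)<\infty$. Then for every $f\in\mathcal{F}$ and every $x\in\mathcal{D}$ outside a set of Lebesgue measure zero, $S_n(x):=S_{n,m(n)}(x)\to0$ almost surely as $n\to\infty$.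
   Context: $\mathcal{F}$ is the set of all measurable functions $f:\mathcal{D}\to[-a,+a]$. $p_X$ is a probability density on $\mathcal{D}$ (absolutely continuous w.r.t. Lebesgue measure) whose support is $\mathcal{D}$. $\mathcal{P}_Z$ is the set of all probability distributions on $\mathbb{R}$ with mean zero and support contained in $[-b,+b]$. Given $n$, let $X_1,\dots,X_n$ be i.i.d. with density $p_X$, $Z_1,\dots,Z_n$ i.i.d. with distribution $p_Z$, and $T_1,\dots,T_n$ i.i.d. uniform on $[-c,+c]$, all mutually independent; $Y_i=f(X_i)+Z_i$, and $B_i=+1$ if $Y_i>T_i$, $B_i=-1$ otherwise. Inner product $\langle g,h\rangle=\int_{\mathcal{D}}g h^*\,dx$. The estimator is $\hat\alpha_j:=\frac{c}{n}\sum_{i=1}^n\frac{\phi_j^*(X_i)}{p_X(X_i)}B_i$ and $\hat f_{n,m}:=\sum_{j=0}^{m-1}\hat\alpha_j\phi_j$; the $m$-term approximation is $f_m:=\sum_{j=0}^{m-1}\langle f,\phi_j\rangle\phi_j$. *)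

(* Defs.v *)
From HB Require Import structures.
From mathcomp Require Import all_boot all_order all_algebra.
From mathcomp Require Import all_classical all_reals all_analysis.
From mathcomp Require Import complex.

Set Implicit Arguments.
Unset Strict Implicit.
Unset Printing Implicit Defensive.

Import Order.TTheory GRing.Theory Num.Theory.
Import numFieldNormedType.Exports.

Local Open Scope classical_set_scope.
Local Open Scope ring_scope.

Definition disp_of {d} (T : measurableType d) := d.

Fixpoint Rd_disp (R : realType) (n : nat) : measure_display :=
  match n with
  | 0 => default_measure_display
  | n.+1 => measure_prod_display (disp_of (measurableTypeR R), Rd_disp R n)
  end.

Fixpoint Rd (R : realType) (n : nat) : measurableType (Rd_disp R n) :=
  match n return measurableType (Rd_disp R n) with
  | 0 => unit
  | n.+1 => (measurableTypeR R * Rd R n)%type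
  end.

Fixpoint lebRd (R : realType) (n : nat) : {measure set (Rd R n) -> \bar R} :=
  match n return {measure set (Rd R n) -> \bar R} with
  | 0 => @dirac _ unit tt R
  | n.+1 => (@lebesgue_measure R \x^ lebRd R n)%E
  end.

(* the canonical identification of Rd R n with the row vectors 'rV[R]_n,
   used to transport the Euclidean topology *)
Fixpoint toRV (R : realType) (n : nat) : Rd R n -> 'rV[R]_n :=
  match n return Rd R n -> 'rV[R]_n with
  | 0 => fun _ => 0
  | n.+1 => fun x => row_mx (\row_(_ < 1) (x.1 : R)) (toRV (x.2))
  end.

Definition compactRd (R : realType) (n : nat) (D : set (Rd R n)) : Prop :=
  compact (@toRV R n @` D).

Definition cRe (R : realType) (z : R[i]) : R := let: Complex a _ := z in a.
Definition cIm (R : realType) (z : R[i]) : R := let: Complex _ b := z in b.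
Definition cmod (R : realType) (z : R[i]) : R :=
  Num.sqrt (cRe z ^+ 2 + cIm z ^+ 2).

Definition inner (R : realType) (n : nat) (D : set (Rd R n))
    (g h : Rd R n -> R[i]) : R[i] :=
  Complex (Rintegral (lebRd R n) D (fun x => cRe (g x * conjc (h x))))
          (Rintegral (lebRd R n) D (fun x => cIm (g x * conjc (h x)))).

Definition L2 (R : realType) (n : nat) (D : set (Rd R n))
    (g : Rd R n -> R[i]) : Prop :=
  [/\ measurable_fun D (fun x => cRe (g x)),
      measurable_fun D (fun x => cIm (g x)) &
      (\int[lebRd R n]_(x in D) ((cmod (g x)) ^+ 2)%:E < +oo)%E].

Definition orthonormal_basis (R : realType) (n : nat) (D : set (Rd R n))
    (phi : nat -> Rd R n -> R[i]) : Prop :=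
  [/\ forall j, L2 D (phi j),
      forall j k, inner D (phi j) (phi k) = (j == k)%:R &
      forall g, L2 D g ->
        (fun m => Rintegral (lebRd R n) D
           (fun x => (cmod (g x - \sum_(j < m) inner D g (phi j) * phi j x)) ^+ 2))
        @ \oo --> (0 : R)].

Definition toC (R : realType) (n : nat) (f : Rd R n -> R) : Rd R n -> R[i] :=
  fun x => Complex (f x) 0.

Definition inF (R : realType) (n : nat) (D : set (Rd R n)) (a : R)
    (f : Rd R n -> R) : Prop :=
  measurable_fun D f /\ (forall x, D x -> - a <= f x <= a).

(* X_i (i >= 0) i.i.d. with density pX on D (w.r.t. Lebesgue measure),
   Z_i i.i.d. with law pZ, T_i i.i.d. uniform on [-c, c], and the whole
   family {X_i, Z_i, T_i}_i mutually independent: for every n and all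
   Borel sets, the joint probability factorizes. *)
Definition sampling_model (R : realType) (n : nat) (D : set (Rd R n))
    (dO : measure_display) (Omega : measurableType dO)
    (P : probability Omega R)
    (X : nat -> Omega -> Rd R n) (Z T : nat -> Omega -> R)
    (pX : Rd R n -> R) (pZ : probability R R) (c : R) : Prop :=
  [/\ (forall i, measurable_fun setT (X i)),
      (forall i, measurable_fun setT (Z i)),
      (forall i, measurable_fun setT (T i)) &
      forall (k : nat) (A : nat -> set (Rd R n)) (B C : nat -> set R),
        (forall i, measurable (A i)) ->
        (forall i, measurable (B i)) ->
        (forall i, measurable (C i)) ->
        P (\bigcap_(i in `I_k)
             (X i @^-1` A i `&` Z i @^-1` B i `&` T i @^-1` C i)) =
        (\prod_(i < k)
           ((\int[lebRd R n]_(x in A i `&` D) (pX x)%:E) * pZ (B i) *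
            (\int[@lebesgue_measure R]_(t in C i) (uniform_pdf (- c) c t)%:E)))%E].

Definition Bsign (R : realType) (n : nat) (dO : measure_display)
    (Omega : measurableType dO)
    (X : nat -> Omega -> Rd R n) (Z T : nat -> Omega -> R)
    (f : Rd R n -> R) (i : nat) (w : Omega) : R :=
  if T i w < f (X i w) + Z i w then 1 else -1.

Definition alpha_hat (R : realType) (n : nat) (dO : measure_display)
    (Omega : measurableType dO)
    (X : nat -> Omega -> Rd R n) (Z T : nat -> Omega -> R)
    (pX : Rd R n -> R) (phi : nat -> Rd R n -> R[i]) (c : R)
    (f : Rd R n -> R) (N j : nat) (w : Omega) : R[i] :=
  Complex (c / N%:R) 0 *
  \sum_(i < N) (conjc (phi j (X i w)) / Complex (pX (X i w)) 0 *
                Complex (Bsign X Z T f i w) 0).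

Definition f_hat (R : realType) (n : nat) (dO : measure_display)
    (Omega : measurableType dO)
    (X : nat -> Omega -> Rd R n) (Z T : nat -> Omega -> R)
    (pX : Rd R n -> R) (phi : nat -> Rd R n -> R[i]) (c : R)
    (f : Rd R n -> R) (N m : nat) (x : Rd R n) (w : Omega) : R[i] :=
  \sum_(j < m) alpha_hat X Z T pX phi c f N j w * phi j x.

Definition f_m (R : realType) (n : nat) (D : set (Rd R n))
    (phi : nat -> Rd R n -> R[i]) (f : Rd R n -> R) (m : nat)
    (x : Rd R n) : R[i] :=
  \sum_(j < m) inner D (toC f) (phi j) * phi j x.

(* Main.v *)
Require Import Defs.
From HB Require Import structures.
From mathcomp Require Import all_boot all_order all_algebra.
From mathcomp Require Import all_classical all_reals all_analysis.
From mathcomp Require Import complex.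
From mathcomp Require Import measurable_realfun.
From mathcomp Require Import ring lra.
From mathcomp Require finmap.
Import Order.TTheory GRing.Theory Num.Theory.
Import numFieldNormedType.Exports.
Local Open Scope classical_set_scope.
Local Open Scope ring_scope.

(** Fix [x] and put [K_m(x, y) = \sum_(j < m) phi_j(x) conj(phi_j(y)) / pX(y)].
    Then [fhat_{n,m}(x)] is the empirical mean of the i.i.d. variables
    [c K_m(x, X_i) B_i]. Given [X] and [Z], a uniform threshold on [-c, c] makes
    the bit [B] an unbiased estimate of [(f(X) + Z) / c], so the common mean is
    [\int_D K_m(x, y) f(y) pX(y) dy = f_m(x)]. Bound (1) makes the summands
    bounded by [c C1 Lambda_m]; Hoeffding's inequality (with non-optimal
    constants), summability (3) and Borel-Cantelli conclude, separately for the
    real and the imaginary part. *)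

(** * Densities and uniqueness of finite measures on products *)

(** The summand [c K_{m(n)}(x, .) B] changes with [n], so the sums are not partial sums of one
    i.i.d. sequence and the classical strong law does not apply; a tail bound for each [n]
    separately, fed to Borel-Cantelli, does. Independence is given only as a product formula on
    triples of Borel sets, whereas Hoeffding needs the expectation of a product of exponentials to
    factorize. Passing from sets to functions goes through uniqueness of finite measures on nested
    products. Bound (1) fails on a null set [N] that depends on [x]. The law of each [X_i] has a
    density, so almost surely no sample meets [N], and the kernel may be replaced by zero off
    [D \ N]. The summands are then bounded everywhere. Hypothesis (3) is assumed for every [eps], so
    any fixed factor ([c], [C1], the [1/6] of the tail bound) is absorbed into [eps]. This is why an
    elementary version of Hoeffding's inequality suffices. *)

Section density_measure.
Local Open Scope ereal_scope.
Context {d : measure_display} {T : measurableType d} {R : realType}.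
Variables (mu : {measure set T -> \bar R}) (p : T -> R).

(** The proofs [mp] and [p0] are arguments so that the measure structure built below can be inferred
    from the term alone. *)
Definition density_measure (mp : measurable_fun setT p)
    (p0 : forall x, (0 <= p x)%R) (A : set T) : \bar R :=
  \int[mu]_(x in A) (p x)%:E.

Hypotheses (mp : measurable_fun setT p) (p0 : forall x, (0 <= p x)%R).
Local Notation nu := (density_measure mp p0).

Let nu0 : nu set0 = 0.
Proof. by rewrite /density_measure integral_set0. Qed.

Let nu_ge0 A : 0 <= nu A.
Proof. by apply: integral_ge0 => x _; rewrite lee_fin. Qed.

Let nu_sigma_additive : semi_sigma_additive nu.
Proof.
move=> F mF tF mUF; rewrite /density_measure; apply: cvg_toP.
  apply: ereal_nondecreasing_is_cvgn => m n mn.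
  apply: lee_sum_nneg_natr => // k _ _.
  by apply: integral_ge0 => x _; rewrite lee_fin.
rewrite ge0_integral_bigcup//=.
- by apply: measurable_funTS; exact/measurable_EFinP.
- by move=> x _; rewrite lee_fin.
Qed.

HB.instance Definition _ := isMeasure.Build _ _ _ nu
  nu0 nu_ge0 nu_sigma_additive.

Import HBNNSimple.

(** Both sides are additive and pass to the limit along increasing simple functions; for an
    indicator the identity is the definition of [nu]. *)
Lemma ge0_integral_density (f : T -> \bar R) :
  measurable_fun setT f -> (forall x, 0 <= f x) ->
  \int[nu]_x f x = \int[mu]_x (f x * (p x)%:E).
Proof.
move=> mf f0; pose h := nnsfun_approx measurableT mf.
have mpE : measurable_fun setT (EFin \o p) by exact/measurable_EFinP.
have -> : \int[nu]_x f x = lim (\int[nu]_x (EFin \o h n) x @[n --> \oo]).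
  have fE x : f x = lim ((EFin \o h n) x @[n --> \oo]).
    by apply/esym/cvg_lim => //; exact: cvg_nnsfun_approx.
  under eq_integral do rewrite fE.
  apply: monotone_convergence => //.
  - by move=> n; apply/measurable_EFinP.
  - by move=> n x _ //=; rewrite lee_fin.
  - by move=> x _ a b ab; rewrite lee_fin; exact/lefP/nd_nnsfun_approx.
have -> : \int[mu]_x (f x * (p x)%:E) =
    lim (\int[mu]_x ((EFin \o h n) x * (p x)%:E) @[n --> \oo]).
  have fg x : f x * (p x)%:E = lim ((EFin \o h n) x * (p x)%:E @[n --> \oo]).
    by apply/esym/cvg_lim => //; apply: cvgeZr => //; exact: cvg_nnsfun_approx.
  under eq_integral do rewrite fg.
  apply: monotone_convergence => [//| | |].
  - by move=> n; apply/emeasurable_funM => //; exact/measurable_EFinP.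
  - by move=> n x _ /=; rewrite mule_ge0 ?lee_fin.
  - move=> x _ a b ab/=; rewrite lee_wpmul2r ?lee_fin //.
    exact/lefP/nd_nnsfun_approx.
congr (limn _); apply/funext => n.
transitivity (\int[nu]_x
   (\sum_(y \in range (h n)) (y * \1_(h n @^-1` [set y]) x)%:E)).
  by apply: eq_integral => t tE; rewrite /= fimfunE -fsumEFin.
have indich m r : measurable_fun setT (fun x => (r * \1_(h m @^-1` [set r]) x)%:E).
  by apply/measurable_EFinP/measurable_funM.
rewrite ge0_integral_fsum//; last by move=> m y Ey; exact: nnfun_muleindic_ge0.
transitivity (\int[mu]_x (\sum_(y \in range (h n))
    (y * \1_(h n @^-1` [set y]) x)%:E * (p x)%:E)); last first.
  apply: eq_integral => x _.
  rewrite -ge0_mule_fsuml => [|y]; last exact: nnfun_muleindic_ge0.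
  by rewrite fsumEFin // -(fimfunE _ x).
rewrite ge0_integral_fsum//; last 2 first.
  - by move=> y; apply: emeasurable_funM.
  - by move=> m y _; rewrite mule_ge0 ?lee_fin// -lee_fin nnfun_muleindic_ge0.
apply: eq_fsbigr => r rhn.
under [RHS]eq_integral do rewrite EFinM -muleA.
(* Since [h n] is nonnegative, the fibre over a negative [r] is empty and both terms vanish;
   otherwise the scalar [r] may leave the integrals. *)
have [r0|r0] := ltP r 0%R.
  have nor x : \1_(h n @^-1` [set r]) x = 0%R :> R.
    rewrite indicE; case: (boolP (x \in _)) => //; rewrite inE /= => hr.
    have : (0 <= h n x)%R by apply: fun_ge0.
    by rewrite hr leNgt r0.
  under [LHS]eq_integral do rewrite nor mulr0.
  under [RHS]eq_integral do rewrite nor mul0e mule0.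
  by rewrite !integral0.
under [LHS]eq_integral do rewrite EFinM.
rewrite !ge0_integralZl//.
- congr (_ * _); rewrite integral_indic//= setIT /density_measure.
  rewrite [LHS]integral_mkcond/=; apply: eq_integral => x _.
  by rewrite patchE indicE; case: ifPn => _; rewrite ?mul1e ?mul0e.
- apply: emeasurable_funM => //; exact/measurable_EFinP.
- by move=> x _; rewrite mule_ge0 ?lee_fin.
- exact/measurable_EFinP.
Qed.

End density_measure.

Section finite_measure_prod.
Local Open Scope ereal_scope.

(* As in Dynkin's theorem, a pi-system generating the sigma-algebra is
   determining. *)
Definition determining {d} {T : measurableType d} (R : realType)
    (G : set (set T)) :=
  forall m1 m2 : {measure set T -> \bar R}, m1 setT < +oo ->
  (forall A, G A -> m1 A = m2 A) ->
  forall A, measurable A -> m1 A = m2 A.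

Definition rectangles {d1 d2} {T1 : measurableType d1} {T2 : measurableType d2}
    (G : set (set T2)) : set (set (T1 * T2)) :=
  [set A `*` B | A in measurable & B in G].

Context {d1 d2 : measure_display} {T1 : measurableType d1}
  {T2 : measurableType d2} (R : realType).

Lemma determining_measurable : @determining _ T2 R measurable.
Proof. by move=> m1 m2 _ m12. Qed.

(** For fixed [A], the two finite measures [B |-> m (A x B)] agree on [G], hence on all measurable
    [B]. The measurable rectangles thus obtained form a generating pi-system. The conclusion has the
    form of the hypothesis, so the lemma can be iterated. *)
Lemma determining_rectangles (G : set (set T2)) :
  G setT -> determining R G ->
  determining R (rectangles G : set (set (T1 * T2)%type)).
Proof.
move=> GT dG m1 m2 m1oo m12.
have m12' A B : measurable A -> measurable B -> m1 (A `*` B) = m2 (A `*` B).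
  move=> mA mB.
  have mAT : measurable (A `*` [set: T2]) by exact: measurableX.
  (* Writing the slice as the image of a restriction makes it a measure by construction. *)
  have E (m : {measure set (T1 * T2) -> \bar R}) B' :
      pushforward (mrestr m mAT) snd B' = m (A `*` B').
    rewrite /pushforward /mrestr; congr (m _).
    by apply/seteqP; split => -[x y] /= => [[? []]|[]].
  have msnd : measurable_fun setT (@snd T1 T2) by exact: measurable_snd.
  rewrite -(E m1 B) -(E m2 B).
  apply: (dG _ _ _ _ B mB) => /=.
  - apply: le_lt_trans m1oo.
    by apply: (le_trans (_ : _ <= m1 (A `*` setT))); rewrite ?E// le_measure ?inE.
  - by move=> C GC; rewrite (E m1 C) (E m2 C); apply: m12; exists A => //; exists C.
apply: (@measure_unique _ R _
  [set A `*` B | A in measurable & B in measurable] (fun _ => setT)) => //.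
- by rewrite measurable_prod_measurableType.
- move=> _ _ [A1 mA1 [B1 mB1 <-]] [A2 mA2 [B2 mB2 <-]].
  exists (A1 `&` A2); first exact: measurableI.
  by exists (B1 `&` B2); [exact: measurableI|rewrite setXI].
- by move=> _; exists setT => //; exists setT => //; rewrite setXTT.
- by rewrite bigcup_const//; exists 0%N.
- by move=> _ [A mA [B mB <-]]; exact: m12'.
Qed.

End finite_measure_prod.

(** * Expectation of a product of i.i.d. factors *)

Lemma bounded_integrable {d} {T : measurableType d} {R : realType}
    (mu : {finite_measure set T -> \bar R}) (h : T -> R) (M : R) :
  measurable_fun setT h -> (forall x, `|h x| <= M) ->
  mu.-integrable setT (EFin \o h).
Proof.
move=> mh hM; apply: measurable_bounded_integrable => //.
  by rewrite -ge0_fin_numE// fin_num_measure.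
exists M; split; first exact: num_real.
by move=> N MN x _ /=; apply: le_trans (hM x) (ltW MN).
Qed.

Lemma Rintegral_indic {d} {T : measurableType d} {R : realType}
    (mu : {measure set T -> \bar R}) (A : set T) :
  measurable A -> Rintegral mu setT \1_A = fine (mu A).
Proof. by move=> mA; rewrite /Rintegral integral_indic// setIT. Qed.

Section independent_product.
Context {dO dE : measure_display} {Omega : measurableType dO}
  {E : measurableType dE} {R : realType}.
Variables (P : probability Omega R) (V : nat -> Omega -> E)
  (Q : probability E R) (G : set (set E)).
Hypotheses (mV : forall i, measurable_fun setT (V i))
  (mG : G `<=` measurable) (GT : G setT) (detG : determining R G).
Hypothesis indep : forall k (S : nat -> set E), (forall i, G (S i)) ->
  P (\bigcap_(i in `I_k) (V i @^-1` S i)) = (\prod_(i < k) Q (S i))%E.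

(* Independence is only known on the sets of [G]. The factors are therefore
   released one index at a time: the first [j] functions are arbitrary, the
   remaining ones are indicators of sets of [G], and in the step the other
   factors serve as the density of a measure determined by its values on [G]. *)
Let integral_prod_mixed (k j : nat) (h : nat -> E -> R) (M : R) :
  (j <= k)%N ->
  (forall i, measurable_fun setT (h i)) ->
  (forall i x, 0 <= h i x <= M) ->
  (forall i, (j <= i)%N -> exists2 S, G S & h i = \1_S) ->
  (\int[P]_w (\prod_(i < k) h i (V i w))%:E
   = (\prod_(i < k) Rintegral Q setT (h i))%:E)%E.
Proof.
elim: j h M => [|j IH] h M jk mh hM hS.
  (* Base case: a product of indicators is the indicator of the intersection, whose probability
     [indep] supplies. *)
  have /choice[S GS] : forall i, exists S, G S /\ h i = \1_S.
    by move=> i; have [//|S GS hE] := hS i _; exists S.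
  pose C := \bigcap_(i in `I_k) (V i @^-1` S i).
  have mC : measurable C.
    apply: bigcap_measurableType => i _; rewrite -[_ @^-1` _]setTI.
    by apply: mV => //; apply: mG; exact: (GS i).1.
  transitivity (\int[P]_w (\1_C w)%:E)%E.
    apply: eq_integral => w _; congr EFin.
    rewrite indicE; case: (boolP (w \in C)) => [|/negP wC].
      rewrite inE => wC; apply: big1 => i _.
      by have /= := wC i (ltn_ord i); rewrite (GS i).2 indicE => /mem_set ->.
    have [i ik wi] : exists2 i, (i < k)%N & ~ S i (V i w).
      apply: contrapT => H; apply: wC; rewrite inE => i /= ik.
      by apply: contrapT => wi; apply: H; exists i.
    rewrite (bigD1 (Ordinal ik))//= (GS i).2 indicE.
    by rewrite memNset// mul0r.
  rewrite integral_indic// setIT; apply: etrans (indep k S (fun i => (GS i).1)) _.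
  rewrite -prodEFin; apply: eq_bigr => i _.
  have mSi : measurable (S i) by apply: mG; exact: (GS i).1.
  by rewrite (GS i).2 Rintegral_indic// fineK// fin_num_measure.
pose jo := Ordinal jk.
pose p w := \prod_(i < k) (if i != jo then h i (V i w) else 1).
pose c := \prod_(i < k | i != jo) Rintegral Q setT (h i).
have p0 w : 0 <= p w.
  by apply: prodr_ge0 => i _; case: ifP => // _; case/andP: (hM i (V i w)).
have mp : measurable_fun setT p.
  apply: measurable_prod => i _; case: (i != jo) => //.
  exact: measurableT_comp.
have c0 : 0 <= c.
  apply: prodr_ge0 => i _; apply: Rintegral_ge0 => x _.
  by case/andP: (hM i x).
(* Putting an indicator in position [j] brings the family within reach of the induction hypothesis;
   the bound becomes [max M 1] to cover the indicator. *)
have key g S : G S -> g = \1_S ->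
    (\int[P]_w (g (V j w) * p w)%:E = (Rintegral Q setT g * c)%:E)%E.
  move=> GS gS; pose h' i := if i == j then g else h i.
  have h'j : h' j = g by rewrite /h' eqxx.
  have := IH h' (Num.max M 1) (ltnW jk); rewrite (bigD1 jo)//= h'j.
  have -> : \prod_(i < k | i != jo) Rintegral Q setT (h' i) = c.
    by apply: eq_bigr => i ij; rewrite /h' -[_ == j]/(i == jo) (negbTE ij).
  move=> <-.
  - apply: eq_integral => w _; rewrite (bigD1 jo)//= h'j /p.
    rewrite -big_mkcond/=; congr (_ * _)%:E.
    by apply: eq_bigr => i ij; rewrite /h' -[_ == j]/(i == jo) (negbTE ij).
  - move=> i; rewrite /h'; case: ifP => // _; rewrite gS.
    by apply: measurable_indic; exact: mG.
  - move=> i x; rewrite /h'; case: ifP => _.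
      by rewrite gS indicE le_max; case: (x \in S); rewrite /= ?ler01 ?lexx ?orbT.
    by case/andP: (hM i x) => -> hm; rewrite le_max hm.
  - move=> i; rewrite leq_eqVlt /h' => /predU1P[<-|ji].
      by rewrite eqxx; exists S.
    by rewrite gtn_eqF//; exact: hS.
(* [key] says that the image under [V j] of [P] weighted by the other factors agrees on [G] with [c]
   times [Q]; [detG] extends this to all measurable sets, and integrating [h j] closes the step. *)
pose nu1 := pushforward (density_measure P p mp p0) (V j).
pose nu2 := mscale (NngNum c0) Q.
have nu12G S : G S -> nu1 S = nu2 S.
  move=> GS; have mS := mG _ GS.
  transitivity (\int[P]_w (\1_S (V j w) * p w)%:E)%E.
    rewrite /nu1 /pushforward /density_measure integral_mkcond/=.
    apply: eq_integral => w _; rewrite patchE indicE.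
    have -> : (w \in V j @^-1` S) = (V j w \in S) by [].
    by case: ifP; rewrite ?mul1r ?mul0r.
  rewrite (key _ S)// Rintegral_indic// /nu2 /mscale /= EFinM muleC.
  by rewrite fineK// fin_num_measure.
have nu1oo : (nu1 setT < +oo)%E.
  by rewrite nu12G// /nu2 /mscale/= probability_setT mule1 ltry.
have nu12 A : measurable A -> nu1 A = nu2 A.
  apply: (detG (pushforward (density_measure P p mp p0) (V j)) nu2).
    exact: nu1oo.
  exact: nu12G.
rewrite (bigD1 jo)//= -/c.
have hj0 x : (0 <= (h j x)%:E)%E by rewrite lee_fin; case/andP: (hM j x).
transitivity (\int[P]_w ((EFin \o h j \o V j) w * (p w)%:E))%E.
  apply: eq_integral => w _; rewrite (bigD1 jo)//= /p EFinM.
  by rewrite -big_mkcond.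
rewrite -[LHS](ge0_integral_density P p mp p0 (EFin \o h j \o V j))//=; last first.
  by apply/measurable_EFinP; exact: measurableT_comp (mh j) (mV j).
have mhE : measurable_fun setT (EFin \o h j) by exact/measurable_EFinP.
have := ge0_integral_pushforward (mV j) (density_measure P p mp p0)
  measurableT mhE (fun x _ => hj0 x).
rewrite preimage_setT => <-.
rewrite (eq_measure_integral nu2); last by move=> A mA _; exact: nu12.
rewrite ge0_integral_mscale//= EFinM muleC /Rintegral fineK//.
apply: integrable_fin_num => //; apply: (bounded_integrable _ _ M) => // x.
by rewrite ger0_norm; case/andP: (hM j x).
Qed.

Lemma integral_prod_indep (k : nat) (h : E -> R) (M : R) :
  measurable_fun setT h -> (forall x, 0 <= h x <= M) ->
  (\int[P]_w (\prod_(i < k) h (V i w))%:E = ((Rintegral Q setT h) ^+ k)%:E)%E.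
Proof.
(* From index [k] on, the family is padded with the indicator of the whole space, which belongs to
   [G], as the mixed lemma requires there; the product over [i < k] is unchanged. *)
move=> mh hM; pose h' i := if (i < k)%N then h else \1_setT.
have h'E (i : 'I_k) : h' i = h by rewrite /h' ltn_ord.
have := integral_prod_mixed k k h' (Num.max M 1) (leqnn k) _ _ _.
under eq_integral do under eq_bigr do rewrite h'E.
under [X in _ = X%:E]eq_bigr do rewrite h'E.
rewrite prodr_const card_ord; apply.
- by move=> i; rewrite /h'; case: ifP => // _; exact: measurable_indic.
- move=> i x; rewrite /h' le_max; case: ifP => _.
    by case/andP: (hM x) => -> ->.
  by rewrite indicT/= ler01 lexx orbT.
- by move=> i ki; rewrite /h' ltnNge ki; exists setT.
Qed.

End independent_product.

(** * Hoeffding's inequality *)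

(* Square [expR (x / 2) <= (1 - x / 2)^-1]. *)
Lemma expR_le_quadratic {R : realType} (x : R) :
  x <= 1 -> expR x <= 1 + x + 2 * x ^+ 2.
Proof.
move=> x1.
have y0 : 0 < 1 - x / 2 by lra.
have e1 : 1 - x / 2 <= expR (- (x / 2)) by have := expR_ge1Dx (- (x / 2)); lra.
have : expR (x / 2) * (1 - x / 2) <= 1.
  have ee : expR (x / 2) * expR (- (x / 2)) = 1 by rewrite -expRD subrr expR0.
  by rewrite -[leRHS]ee ler_pM2l ?expR_gt0.
have -> : expR x = expR (x / 2) ^+ 2 by rewrite -expRM_natl; congr expR; field.
set e := expR (x / 2); set y := 1 - x / 2 => ey.
have e0 : 0 < e by rewrite expR_gt0.
have ey2 : e ^+ 2 * y ^+ 2 <= 1.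
  by rewrite -exprMn expr_le1// mulr_ge0// ltW.
rewrite -(@ler_pM2r _ (y ^+ 2)); last by rewrite exprn_gt0.
apply: le_trans ey2 _.
(* The correction term has the sign of [(1 - x) * (5 - 2 * x)], nonnegative because [x <= 1]. *)
have -> : (1 + x + 2 * x ^+ 2) * y ^+ 2
    = 1 + x ^+ 2 * ((1 - x) * (5 - 2 * x)) / 4 by rewrite /y; field.
rewrite lerDl divr_ge0// mulr_ge0// ?sqr_ge0// mulr_ge0//; lra.
Qed.

(** Shaped for centred variables: the linear term integrates to zero and a Gaussian bound remains.
    For [x > 1] the crude [x <= 2 * x ^+ 2] is enough. *)
Lemma expR_le_expR_sqr {R : realType} (x : R) :
  expR x <= x + expR (2 * x ^+ 2).
Proof.
have [x1|x1] := leP x 1.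
  have := expR_le_quadratic x x1; have := expR_ge1Dx (2 * x ^+ 2); lra.
have : expR x <= expR (2 * x ^+ 2) by rewrite ler_expR; nra.
lra.
Qed.

Lemma Rintegral_expR_centered {d} {T : measurableType d} {R : realType}
    (Q : probability T R) (h : T -> R) (L t : R) :
  measurable_fun setT h -> (forall x, `|h x| <= L) ->
  Rintegral Q setT h = 0 ->
  Rintegral Q setT (fun x => expR (t * h x)) <= expR (2 * (t * L) ^+ 2).
Proof.
move=> mh hL h0.
have ih : Q.-integrable setT (EFin \o h) by exact: bounded_integrable hL.
have ith : Q.-integrable setT (EFin \o (fun x => t * h x)).
  apply: (bounded_integrable _ _ (`|t| * L)) => [|x].
    exact: measurable_funM.
  by rewrite normrM ler_wpM2l.
have ic (c : R) : Q.-integrable setT (EFin \o (fun=> c)).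
  exact: finite_measure_integrable_cst.
have hL2 x : (t * h x) ^+ 2 <= (t * L) ^+ 2.
  rewrite -[leLHS]real_normK ?num_real// -[leRHS]real_normK ?num_real//.
  rewrite ler_sqr ?nnegrE// !normrM ler_wpM2l//.
  exact: le_trans (hL x) (ler_norm _).
apply: (@le_trans _ _
    (Rintegral Q setT (fun x => t * h x + expR (2 * (t * L) ^+ 2)))).
  apply: le_Rintegral => //.
  - apply: (bounded_integrable _ _ (expR (`|t| * L))) => [|x].
      by apply: measurableT_comp => //; exact: measurable_funM.
    rewrite ger0_norm ?expR_ge0// ler_expR (le_trans (ler_norm _))//.
    by rewrite normrM ler_wpM2l.
  - exact: (integrableD measurableT ith (ic (expR (2 * (t * L) ^+ 2)))).
  - move=> x _; apply: le_trans (expR_le_expR_sqr _) _.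
    by rewrite lerD2l ler_expR ler_wpM2l.
rewrite RintegralD// RintegralZl// h0 mulr0 add0r Rintegral_cst//.
have -> : fine (Q setT) = 1 by exact: (congr1 fine (probability_setT Q)).
by rewrite mulr1.
Qed.

Section hoeffding.
Context {dO dE : measure_display} {Omega : measurableType dO}
  {E : measurableType dE} {R : realType}.
Variables (P : probability Omega R) (V : nat -> Omega -> E)
  (Q : probability E R) (G : set (set E)).
Hypotheses (mV : forall i, measurable_fun setT (V i))
  (mG : G `<=` measurable) (GT : G setT) (detG : determining R G).
Hypothesis indep : forall k (S : nat -> set E), (forall i, G (S i)) ->
  P (\bigcap_(i in `I_k) (V i @^-1` S i)) = (\prod_(i < k) Q (S i))%E.

(* For [L = 0] the quotient on the right is [0] and the bound is trivial. *)
Lemma hoeffding_centered (h : E -> R) (L eps : R) (n : nat) :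
  measurable_fun setT h -> 0 <= L -> (forall x, `|h x| <= L) ->
  Rintegral Q setT h = 0 -> 0 < eps ->
  (P [set w | n%:R * eps <= \sum_(i < n) h (V i w)]%R <=
   (expR (- (n%:R * eps ^+ 2 / (8 * L ^+ 2))))%:E)%E.
Proof.
move=> mh L_ge0 hL h0 eps0.
pose S w := \sum_(i < n) h (V i w).
have mS : measurable_fun setT S.
  by apply: measurable_sum => i; exact: measurableT_comp mh (mV i).
have SM : S \in mfun by rewrite inE.
have mA : measurable [set w | n%:R * eps <= S w].
  rewrite -[X in measurable X]setTI.
  exact: (measurable_fun_le measurableT (measurable_cst _) mS).
have [->|L_neq0] := eqVneq L 0.
  by rewrite expr0n/= mulr0 invr0 mulr0 oppr0 expR0 probability_le1.
have L0 : 0 < L by rewrite lt_def L_neq0.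
(* This [t] minimizes the Chernoff exponent [2 * (t * L) ^+ 2 - t * eps], with minimum
   [- eps ^+ 2 / (8 * L ^+ 2)]. *)
pose t := eps / (4 * L ^+ 2).
have t0 : 0 < t by rewrite divr_gt0// mulr_gt0// exprn_gt0.
have := @chernoff _ _ _ P (mfun_Sub SM) t (n%:R * eps) t0.
rewrite /mmt_gen_fun unlock /= => /le_trans; apply.
have -> : (\int[P]_w (expR (S w * t))%:E)%E =
    (Rintegral Q setT (fun x => expR (t * h x)) ^+ n)%:E.
  rewrite -(integral_prod_indep P V Q G mV mG GT detG indep n _ (expR (t * L))).
  - by apply: eq_integral => w _; rewrite -expR_sum -mulr_sumr mulrC.
  - by apply: measurableT_comp => //; exact: measurable_funM.
  - move=> x; rewrite expR_ge0 ler_expR ler_wpM2l ?(ltW t0)//.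
    exact: le_trans (ler_norm _) (hL x).
rewrite -EFinM lee_fin.
have q0 : 0 <= Rintegral Q setT (fun x => expR (t * h x)).
  by apply: Rintegral_ge0 => x _; exact: expR_ge0.
apply: (@le_trans _ _
    (expR (2 * (t * L) ^+ 2) ^+ n * expR (- (t * (n%:R * eps))))).
  rewrite ler_wpM2r ?expR_ge0// lerXn2r ?nnegrE ?expR_ge0//.
  exact: Rintegral_expR_centered.
rewrite -expRM_natl -expRD ler_expR le_eqVlt; apply/orP; left; apply/eqP.
by rewrite /t; field.
Qed.

End hoeffding.

(** The thresholds [1 / (k + 1)] suffice to test convergence, so the exceptional set is a countable
    union of null limsup events. *)
Lemma borel_cantelli_cvg0 {d} {T : measurableType d} {R : realType}
    (P : probability T R) (S : nat -> T -> R) :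
  (forall n, measurable_fun setT (S n)) ->
  (forall eps, 0 < eps ->
    (\sum_(1 <= n <oo) P [set w | (eps <= `|S n w|)%R] < +oo)%E) ->
  {ae P, forall w, S ^~ w @ \oo --> (0 : R)}.
Proof.
move=> mS sumS.
(* The index is shifted by one because the summable series starts at 1. *)
pose F k n := [set w | k.+1%:R^-1 <= `|S (n + 1)%N w|].
have mF k n : measurable (F k n).
  rewrite -[X in measurable X]setTI; apply: measurable_fun_le => //.
  exact: measurableT_comp.
have F0 k : P (lim_sup_set (F k)) = 0%E.
  apply: lim_sup_set_cvg0 => //.
  rewrite (nneseries_addn (f := fun n => P [set w | k.+1%:R^-1 <= `|S n w|]) 1)//.
  by apply: sumS; rewrite invr_gt0.
have nF : P.-negligible (\bigcup_k lim_sup_set (F k)).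
  apply: negligible_bigcup => k; apply/negligibleP; last exact: F0.
  by apply: bigcap_measurableType => n _; exact: bigcup_measurable.
move: nF; apply: negligibleS => w /= nw.
apply: contrapT => H; apply: nw; apply/cvgr0Pnorm_lt => eps eps0.
have [k] := ltr_add_invr eps0; rewrite add0r => keps.
have : ~ lim_sup_set (F k) w by move=> Fw; apply: H; exists k.
move=> /existsNP[N]; rewrite not_implyE => -[_ NF].
exists N.+1 => // -[//|n] /= Nn; rewrite (le_lt_trans _ keps)// leNgt.
apply/negP => /ltW kS; apply: NF; exists n => //.
by rewrite /F /= addn1.
Qed.

(** * Tail bounds and almost sure convergence for empirical means of functions varying with the
    sample size *)

Section hoeffding_mean.
Context {dO dE : measure_display} {Omega : measurableType dO}
  {E : measurableType dE} {R : realType}.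
Variables (P : probability Omega R) (V : nat -> Omega -> E)
  (Q : probability E R) (G : set (set E)).
Hypotheses (mV : forall i, measurable_fun setT (V i))
  (mG : G `<=` measurable) (GT : G setT) (detG : determining R G).
Hypothesis indep : forall k (S : nat -> set E), (forall i, G (S i)) ->
  P (\bigcap_(i in `I_k) (V i @^-1` S i)) = (\prod_(i < k) Q (S i))%E.

Let empirical_error (g : E -> R) (n : nat) (w : Omega) : R :=
  n%:R^-1 * (\sum_(i < n) g (V i w)) - Rintegral Q setT g.

Let measurable_empirical_error (g : E -> R) (n : nat) :
  measurable_fun setT g -> measurable_fun setT (empirical_error g n).
Proof.
move=> mg; apply: measurable_funB => //; apply: measurable_funM => //.
by apply: measurable_sum => i; exact: measurableT_comp mg (mV i).
Qed.

(** Centring doubles the bound to [2 * M], which gives the exponent [n * eps ^+ 2 / (32 * M ^+ 2)].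
    Weakening 32 to the square 36 puts it in the shape of the summability hypothesis, with [eps / 6]
    for [eps]. *)
Lemma hoeffding_upper (g : E -> R) (M eps : R) (n : nat) : (0 < n)%N ->
  measurable_fun setT g -> 0 <= M -> (forall x, `|g x| <= M) -> 0 < eps ->
  (P [set w | eps <= empirical_error g n w]%R <=
   (expR (- ((eps / 6) ^+ 2 * n%:R) / M ^+ 2))%:E)%E.
Proof.
move=> n0 mg M0 gM eps0; set mu := Rintegral Q setT g.
have ig : Q.-integrable setT (EFin \o g) by exact: bounded_integrable gM.
have icst (c : R) : Q.-integrable setT (EFin \o (fun=> c)).
  exact: finite_measure_integrable_cst.
have Rcst (c : R) : Rintegral Q setT (fun=> c) = c.
  rewrite Rintegral_cst//.
  have -> : fine (Q setT) = 1 by exact: (congr1 fine (probability_setT Q)).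
  by rewrite mulr1.
have muM : `|mu| <= M.
  apply: le_trans (le_normr_Rintegral _ ig) _ => //.
  rewrite -[leRHS]Rcst; apply: le_Rintegral => //.
  by apply: (bounded_integrable _ _ M) => [|x]; rewrite ?normr_id//;
    exact: measurableT_comp.
have := hoeffding_centered P V Q G mV mG GT detG indep (fun x => g x - mu)
  (2 * M) eps n.
move=> /(_ _ _ _ _ eps0) => H.
apply: le_trans (le_trans (H _ _ _ _) _).
- apply: le_measure; rewrite ?inE.
  + rewrite -[X in measurable X]setTI; apply: measurable_fun_le => //.
    exact: measurable_empirical_error.
  + rewrite -[X in measurable X]setTI; apply: measurable_fun_le => //.
    apply: measurable_sum => i; apply: measurable_funB => //.
    exact: measurableT_comp mg (mV i).
  + move=> w /= ew; rewrite sumrB sumr_const card_ord -[mu *+ n]mulr_natl.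
    apply: le_trans (_ : n%:R * empirical_error g n w <= _).
      by rewrite ler_wpM2l.
    by rewrite /empirical_error mulrBr mulrA mulfV ?mul1r// pnatr_eq0 -lt0n.
- exact: measurable_funB.
- by rewrite mulr_ge0.
- move=> x; apply: le_trans (ler_normB _ _) _.
  by have := gM x; lra.
- by rewrite RintegralB// Rcst subrr.
rewrite lee_fin ler_expR mulNr lerN2.
have [->|M_neq0] := eqVneq M 0.
  by rewrite mulr0 expr0n/= mulr0 !invr0 !mulr0.
have -> : n%:R * eps ^+ 2 / (8 * (2 * M) ^+ 2) = n%:R * (eps / M) ^+ 2 / 32 by field.
have -> : (eps / 6) ^+ 2 * n%:R / M ^+ 2 = n%:R * (eps / M) ^+ 2 / 36 by field.
by apply: ler_wpM2l; [rewrite mulr_ge0 ?sqr_ge0|lra].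
Qed.

Lemma hoeffding_two_sided (g : E -> R) (M eps : R) (n : nat) : (0 < n)%N ->
  measurable_fun setT g -> 0 <= M -> (forall x, `|g x| <= M) -> 0 < eps ->
  (P [set w | eps <= `|empirical_error g n w|]%R <=
   2%:E * (expR (- ((eps / 6) ^+ 2 * n%:R) / M ^+ 2))%:E)%E.
Proof.
move=> n0 mg M0 gM eps0.
have mNg : measurable_fun setT (\- g) by exact: measurableT_comp mg.
have ig : Q.-integrable setT (EFin \o g) by exact: bounded_integrable gM.
have RN : Rintegral Q setT (\- g) = - Rintegral Q setT g.
  rewrite -mulN1r -RintegralZl//.
  by apply: eq_Rintegral => x _; rewrite mulN1r.
have eN w : empirical_error (\- g) n w = - empirical_error g n w.
  by rewrite /empirical_error RN sumrN mulrN opprB opprK addrC.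
have mlt h : measurable_fun setT h -> measurable [set w | eps <= empirical_error h n w].
  move=> mh; rewrite -[X in measurable X]setTI; apply: measurable_fun_le => //.
  exact: measurable_empirical_error.
rewrite (_ : [set w | _] = [set w | eps <= empirical_error g n w] `|`
    [set w | eps <= empirical_error (\- g) n w]); last first.
  by apply/seteqP; split=> w /=; rewrite eN ler_normr; [move/orP|move=> H; apply/orP].
apply: le_trans (measureU2 _ _ _) _; [exact: mlt|exact: mlt|].
rewrite [leRHS](_ : _ = (expR (- ((eps / 6) ^+ 2 * n%:R) / M ^+ 2))%:E +
   (expR (- ((eps / 6) ^+ 2 * n%:R) / M ^+ 2))%:E)%E; last first.
  by rewrite -EFinM -EFinD mulr2n mulrDl mul1r.
apply: leeD; apply: hoeffding_upper => // x; by rewrite normrN.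
Qed.

Lemma empirical_mean_cvg_ae (g : nat -> E -> R) (M : nat -> R) :
  (forall n, measurable_fun setT (g n)) ->
  (forall n, (0 < n)%N -> 0 <= M n) ->
  (forall n x, (0 < n)%N -> `|g n x| <= M n) ->
  (forall eps, 0 < eps ->
    (\sum_(1 <= n <oo) (expR (- (eps ^+ 2 * n%:R) / M n ^+ 2))%:E < +oo)%E) ->
  {ae P, forall w,
    (fun n => n%:R^-1 * (\sum_(i < n) g n (V i w)) - Rintegral Q setT (g n))
      @ \oo --> (0 : R)}.
Proof.
move=> mg M0 gM sumM.
apply: (borel_cantelli_cvg0 P (fun n => empirical_error (g n) n)) => [n|eps eps0].
  exact: measurable_empirical_error.
have e6 : 0 < eps / 6 by rewrite divr_gt0.
apply: (@le_lt_trans _ _ (\sum_(1 <= n <oo)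
    (2%:E * (expR (- ((eps / 6) ^+ 2 * n%:R) / M n ^+ 2))%:E))%E); last first.
  rewrite nneseriesZl; last by move=> i _; rewrite lee_fin expR_ge0.
  rewrite lte_mul_pinfty//; last exact: sumM.
(* The termwise comparison is also asked at index 0, where the right-hand side is 2 and bounds any
   probability. *)
apply: lee_nneseries => // -[_|n _]; last first.
  by apply: hoeffding_two_sided => // [|x]; [exact: M0|exact: gM].
rewrite mulr0 oppr0 mul0r expR0 mule1; apply: le_trans (probability_le1 _ _) _.
  rewrite -[X in measurable X]setTI; apply: measurable_fun_le => //.
  by apply: measurableT_comp => //; exact: measurable_empirical_error.
by rewrite lee_fin ler1n.
Qed.

End hoeffding_mean.

(** * Compact subsets of R^d are Borel *)

Lemma toRV_inj (R : realType) (n : nat) : injective (@toRV R n).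
Proof.
elim: n => [|n IH]; first by move=> [] [].
move=> [x u] [y v] /= xyuv; have [/rowP xy /IH uv] := @eq_row_mx _ 1 1 n _ _ _ _ xyuv.
by have := xy ord0; rewrite !mxE /= => ->; rewrite uv.
Qed.

Lemma measurable_toRV (R : realType) (n : nat) (i : 'I_n) :
  measurable_fun setT (fun x : Rd R n => toRV x ord0 i).
Proof.
elim: n i => [[]//|n IH i] /=.
case: (@splitP 1 n i) => j ij.
  rewrite (_ : (fun x => _) = fst); first exact: measurable_fst.
  apply/funext => x.
  have -> : i = lshift n j by apply/val_inj.
  by rewrite (row_mxEl (\row_(_ < 1) x.1)) mxE.
rewrite (_ : (fun x => _) = (fun y => toRV y ord0 j) \o snd); last first.
  apply/funext => x.
  have -> : i = rshift 1 j by apply/val_inj.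
  by rewrite (row_mxEr (\row_(_ < 1) x.1)).
exact: measurableT_comp (IH j) measurable_snd.
Qed.

Lemma measurable_toRV_ball (R : realType) (n : nat) (z : 'rV[R]_n) (e : R) :
  0 < e -> measurable ((@toRV R n) @^-1` ball z e).
Proof.
(* Balls of row vectors are defined coordinatewise, so finitely many measurable conditions cut them
   out. *)
move=> e0; rewrite (_ : _ @^-1` _ = \bigcap_(i in [set: 'I_n])
    [set x | `|z ord0 i - toRV x ord0 i| < e]); last first.
  apply/seteqP; split => x /= zx; first by move=> i _; exact: zx.2.
  by split => // j i; rewrite (ord1 j); exact: zx.
apply: fin_bigcap_measurable => // i _.
rewrite -[X in measurable X]setTI; apply: measurable_fun_ltr => //.
apply: measurableT_comp => //; apply: measurable_funB => //.
exact: measurable_toRV.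
Qed.

Section measurable_compact.
Import finmap.

(** The topology lives on row vectors and the sigma-algebra on iterated products; finite covers by
    balls of radius [1 / (k + 1)] relate them. The centres lie in the compact set, so a point
    covered at every scale is adherent to it, hence in it. *)
Lemma measurable_compactRd (R : realType) (n : nat) (D : set (Rd R n)) :
  compactRd D -> measurable D.
Proof.
rewrite /compactRd; set K := _ @` D => cK.
have DK : D = (@toRV R n) @^-1` K.
  apply/seteqP; split=> x /=; first by move=> Dx; exists x.
  by move=> [y Dy /toRV_inj <-].
have clK : closed K by apply: compact_closed => //; exact: norm_hausdorff.
have cov k : exists F : {fset 'rV[R]_n}, {subset F <= K} /\
    K `<=` \bigcup_(z in [set` F]) ball z k.+1%:R^-1.
  have := cK; rewrite compact_cover => /(_ _ K (fun z => (ball z k.+1%:R^-1)^°)).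
  case=> [z _|z Kz|F FK KF].
  - exact: open_interior.
  - by exists z => //; apply: nbhsx_ballx; rewrite invr_gt0.
  exists F; split => // z /KF[y Fy yz]; exists y => //.
  exact: interior_subset yz.
have {cov}[F FP] := choice cov.
have -> : D = \bigcap_k \bigcup_(z in [set` F k])
    ((@toRV R n) @^-1` ball z k.+1%:R^-1).
  apply/seteqP; split => x.
    rewrite DK => Kx k _; exact: (FP k).2.
  move=> xF; rewrite DK; apply: clK => B /nbhs_ballP[e /= e0 eB].
  have [k] := ltr_add_invr e0; rewrite add0r => ke.
  have [z /= Fz xz] := xF k I; exists z; split.
    exact: set_mem ((FP k).1 z Fz).
  by apply: eB; apply: ball_sym; apply: le_ball xz; exact: ltW.
apply: bigcap_measurableType => k _; apply: fin_bigcup_measurable => // z _.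
by apply: measurable_toRV_ball; rewrite invr_gt0.
Qed.

End measurable_compact.

(** * The dithered one-bit quantizer is unbiased *)

(** Multiplication by [p >= 0] commutes with positive and negative parts, so the nonnegative case
    applies to each. *)
Lemma integral_density {d} {T : measurableType d} {R : realType}
    (mu : {measure set T -> \bar R}) (p : T -> R)
    (mp : measurable_fun setT p) (p0 : forall x, 0 <= p x) (f : T -> R) :
  measurable_fun setT f ->
  (\int[density_measure mu p mp p0]_x (f x)%:E = \int[mu]_x (f x * p x)%:E)%E.
Proof.
move=> mf; have mfE : measurable_fun setT (EFin \o f) by exact/measurable_EFinP.
rewrite [LHS]integralE [RHS]integralE; congr (_ - _)%E.
- rewrite ge0_integral_density//; last exact: measurable_funepos.
  apply: eq_integral => x _; rewrite !funeposE.
  by rewrite -!EFin_max -EFinM maxr_pMl// mul0r.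
- rewrite ge0_integral_density//; last exact: measurable_funeneg.
  apply: eq_integral => x _; rewrite !funenegE.
  by rewrite -!EFinN -!EFin_max -EFinM maxr_pMl// mul0r mulNr.
Qed.

Definition quantize {R : realType} (y t : R) : R := if t < y then 1 else -1.

Lemma normr_quantize {R : realType} (y t : R) : `|quantize y t| = 1.
Proof. by rewrite /quantize; case: ifP; rewrite ?normrN normr1. Qed.

Lemma measurable_quantize {d} {T : measurableType d} {R : realType}
    (y t : T -> R) : measurable_fun setT y -> measurable_fun setT t ->
  measurable_fun setT (fun x => quantize (y x) (t x)).
Proof.
by move=> my mt; apply: measurable_fun_if => //; exact: measurable_fun_ltr.
Qed.

Section dithered_mean.
Context {R : realType} (c : R).
Hypothesis oppc_lt : - c < c.

Let c0 : 0 < c.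
Proof. by move: oppc_lt; lra. Qed.

Local Notation U := (uniform_prob oppc_lt).

Lemma uniform_prob_lt (y : R) : - c <= y <= c ->
  U [set t | t < y] = ((y + c) / (2 * c))%:E.
Proof.
move=> /andP[cy yc].
have -> : U [set t | t < y] =
    (\int[lebesgue_measure]_(t in `[(- c)%R, y[) ((2 * c)^-1)%R%:E)%E.
  rewrite /U /uniform_prob integral_uniform_pdf.
  rewrite (_ : [set t | t < y] `&` `[- c, c]%classic = `[- c, y[%classic).
    apply: eq_integral => t; rewrite inE/= in_itv/= => /andP[ct ty].
    rewrite /uniform_pdf ct (le_trans (ltW ty) yc)/=.
    by congr (_^-1)%:E; ring.
  apply/seteqP; split => t /=; rewrite !in_itv/=.
    by move=> [-> /andP[-> _]].
  by move=> /andP[-> ty]; rewrite ty (le_trans (ltW ty) yc).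
rewrite integral_cst//= lebesgue_measure_itv/= lte_fin.
case: ltP => [_|yc']; first by rewrite -EFinD -EFinM; congr EFin; field; rewrite gt_eqF.
rewrite mule0; have -> : y = - c by apply/le_anti/andP.
by rewrite addNr mul0r.
Qed.

(** The bit is [2 * 1_{t < y} - 1], with mean [2 * (y + c) / (2 * c) - 1]. Linearity in [y] relies
    on [y] lying in the dither range, which is the reason for [c = a + b]. *)
Lemma integral_quantize (y : R) : - c <= y <= c ->
  Rintegral U setT (quantize y) = y / c.
Proof.
move=> yc.
have mA : measurable [set t : R | t < y].
  by rewrite (_ : [set t | t < y] = `]-oo, y[%classic)// set_itvE.
have iI : U.-integrable setT (EFin \o \1_[set t | t < y]).
  exact: integrable_indic.
transitivity (Rintegral U setT
    (fun t => 2 * \1_[set t | t < y] t - (1 : R))).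
  apply: eq_Rintegral => t _; rewrite /quantize indicE.
  case: ifPn => ty; first by rewrite mem_set// mulr1; ring.
  by rewrite memNset ?mulr0 ?sub0r// /=; exact/negP.
rewrite RintegralB//=; last 2 first.
- exact: (integrableZl measurableT 2 iI).
- exact: finite_measure_integrable_cst.
rewrite RintegralZl// Rintegral_indic// Rintegral_cst//.
have -> : fine (U setT) = 1 by exact: (congr1 fine (probability_setT U)).
have -> : fine (U [set t | t < y]) = (y + c) / (2 * c).
  exact: (congr1 fine (uniform_prob_lt y yc)).
by field; rewrite gt_eqF.
Qed.

End dithered_mean.

Lemma EFin_Rintegral {d} {T : measurableType d} {R : realType}
    (mu : {measure set T -> \bar R}) (D : set T) (h : T -> R) :
  measurable D -> mu.-integrable D (EFin \o h) ->
  (\int[mu]_(x in D) (h x)%:E)%E = (Rintegral mu D h)%:E.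
Proof. by move=> mD ih; rewrite /Rintegral fineK//; exact: integrable_fin_num. Qed.

(** The type records that the product is again a probability, so that it can be nested. *)
Definition prod_probability {d1 d2} {T1 : measurableType d1}
    {T2 : measurableType d2} {R : realType} (P1 : probability T1 R)
    (P2 : probability T2 R) : probability (T1 * T2)%type R := (P1 \x P2)%E.

Section prod_probability.
Context {d1 d2} {T1 : measurableType d1} {T2 : measurableType d2}
  {R : realType} (P1 : probability T1 R) (P2 : probability T2 R).
Variables (f : T1 * T2 -> R) (M : R).
Hypotheses (mf : measurable_fun setT f) (fM : forall v, `|f v| <= M).

Let intf : (P1 \x P2)%E.-integrable setT (EFin \o f).
Proof. exact: (bounded_integrable (prod_probability P1 P2) f M). Qed.

Lemma integral_prod_probability :
  (\int[prod_probability P1 P2]_v (f v)%:E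
   = \int[P1]_x fubini_F P2 (EFin \o f) x)%E.
Proof. by rewrite (integral12_prod_meas1 intf). Qed.

Lemma measurable_fubini_prod_probability :
  measurable_fun setT (fubini_F P2 (EFin \o f)).
Proof. exact: (measurable_fubini_F intf). Qed.

End prod_probability.

Section dithered_quantization.
Context {R : realType} (a b : R) (pZ : probability R R).
Hypotheses (meanZ : (\int[pZ]_x x%:E = 0)%E)
  (suppZ : pZ `[- b, b]%classic = 1%E).

Let c := a + b.
Hypotheses (oppc_lt : - c < c) (b0 : 0 <= b).

Let c0 : 0 < c.
Proof. by move: oppc_lt; lra. Qed.
Local Notation U := (uniform_prob oppc_lt).

(* Equal to the identity [pZ]-almost everywhere, but bounded everywhere. *)
Let trunc (z : R) := z * \1_(`[- b, b]%classic) z.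

Let measurable_trunc : measurable_fun setT trunc.
Proof. by apply: measurable_funM => //; exact: measurable_indic. Qed.

Let trunc_ge (z : R) : - b <= trunc z <= b.
Proof.
rewrite /trunc indicE; case: (boolP (z \in _)) => [|_].
  by rewrite inE/= in_itv/= mulr1.
by rewrite mulr0 oppr_le0 b0.
Qed.

Let ae_trunc : {ae pZ, forall z, z = trunc z}.
Proof.
exists (~` `[- b, b]%classic); split; first exact: measurableC.
  have /= -> := probability_setC pZ (measurable_itv `[- b, b]).
  by rewrite [X in (_ - X)%E]suppZ subee.
move=> z /= nz zb; apply: nz; rewrite /trunc indicE mem_set ?mulr1//.
Qed.

Let integrable_trunc : pZ.-integrable setT (EFin \o trunc).
Proof.
by apply: (bounded_integrable _ _ b) => // z; rewrite ler_norml trunc_ge.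
Qed.

Let Rintegral_trunc : Rintegral pZ setT trunc = 0.
Proof.
rewrite /Rintegral -(_ : (\int[pZ]_x x%:E = \int[pZ]_x (trunc x)%:E)%E).
  by rewrite meanZ.
apply: ae_eq_integral => //.
- exact/measurable_EFinP.
- by apply: filterS ae_trunc => z /= zE _; rewrite -zE.
Qed.

(** Fubini with the threshold integrated first gives [(y + z) / c] for [pZ]-almost every [z]; the
    term in [z] then disappears because the noise has mean zero. *)
Lemma Rintegral_dither (y : R) : - a <= y <= a ->
  (\int[prod_probability pZ U]_v (quantize (y + v.1) v.2)%:E = (y / c)%:E)%E.
Proof.
move=> ya.
pose h (v : R * R) := quantize (y + v.1) v.2.
have mh : measurable_fun setT h.
  by apply: measurable_quantize => //; exact: measurable_funD.
have h1 v : `|h v| <= 1 by rewrite normr_quantize.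
apply: etrans (integral_prod_probability pZ U h 1 mh h1) _.
transitivity (\int[pZ]_z ((y + trunc z) / c)%:E)%E.
  apply: ae_eq_integral => //.
  - exact: (measurable_fubini_prod_probability pZ U h 1 mh h1).
  - apply/measurable_EFinP; apply: measurable_funM => //.
    exact: measurable_funD.
  - apply: filterS ae_trunc => z zE _ /=; rewrite /fubini_F /h /=.
    have yzc : - c <= y + z <= c.
      by case/andP: (trunc_ge z); rewrite -zE; case/andP: ya; rewrite /c; lra.
    rewrite EFin_Rintegral//; last first.
      apply: (bounded_integrable _ _ 1) => [|t]; last by rewrite normr_quantize.
      exact: measurable_quantize.
    by rewrite -zE; congr EFin; exact: (integral_quantize c oppc_lt).
have icst (r : R) : pZ.-integrable setT (EFin \o (fun=> r)).
  exact: finite_measure_integrable_cst.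
rewrite EFin_Rintegral//; last first.
  apply: (bounded_integrable _ _ ((a + b) / c)) => [|z].
    by apply: measurable_funM => //; exact: measurable_funD.
  rewrite normrM [`|c^-1|]ger0_norm ?invr_ge0 ?(ltW c0)//.
  rewrite ler_pM2r ?invr_gt0// (le_trans (ler_normD _ _))//.
  by rewrite lerD// ler_norml// trunc_ge.
congr EFin; transitivity (Rintegral pZ setT (fun z => c^-1 * y + c^-1 * trunc z)).
  by apply: eq_Rintegral => z _; rewrite -mulrDr mulrC.
rewrite RintegralD//; last exact: (integrableZl measurableT c^-1 integrable_trunc).
rewrite [X in _ + X]RintegralZl// Rintegral_trunc mulr0 addr0 Rintegral_cst//.
have -> : fine (pZ setT) = 1 by exact: (congr1 fine (probability_setT pZ)).
by rewrite mulr1 mulrC.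
Qed.

Lemma Rintegral_quantize_prod {d} {T : measurableType d} (m : probability T R)
    (g F : T -> R) (M : R) :
  measurable_fun setT g -> (forall x, `|g x| <= M) ->
  measurable_fun setT F -> (forall x, - a <= F x <= a) ->
  Rintegral (prod_probability m (prod_probability pZ U)) setT
    (fun v => g v.1 * quantize (F v.1 + v.2.1) v.2.2)
  = Rintegral m setT (fun x => g x * F x) / c.
Proof.
move=> mg gM mF Fa.
pose h v := g v.1 * quantize (F v.1 + v.2.1) v.2.2.
have mh : measurable_fun setT h.
  apply: measurable_funM; first exact: measurableT_comp.
  apply: measurable_quantize.
    by apply: measurable_funD; exact: measurableT_comp.
  exact: measurableT_comp.
have hM v : `|h v| <= M by rewrite /h normrM normr_quantize mulr1.
rewrite /Rintegral (integral_prod_probability m (prod_probability pZ U) h M mh hM).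
have Rgc : Rintegral m setT (fun x => g x * F x) / c
    = fine (\int[m]_x (c^-1 * (g x * F x))%:E)%E.
  rewrite mulrC -RintegralZl//.
  apply: (bounded_integrable _ _ (M * a)) => [|x]; first exact: measurable_funM.
  by rewrite normrM ler_pM// ler_norml.
rewrite [RHS]Rgc; congr fine; apply: eq_integral => x _.
rewrite /fubini_F /= /h /=.
under eq_integral do rewrite EFinM.
rewrite integralZl//; last first.
  apply: (bounded_integrable (prod_probability pZ U) _ 1) => [|v]; last by rewrite normr_quantize.
  by apply: measurable_quantize => //; exact: measurable_funD.
by rewrite Rintegral_dither// -EFinM; congr EFin; rewrite mulrA mulrC.
Qed.

End dithered_quantization.

(** * Complex-valued integrals *)

Lemma cRe_additive {R : realType} : {morph @cRe R : x y / x + y}.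
Proof. by move=> [? ?] [? ?]. Qed.

Lemma cIm_additive {R : realType} : {morph @cIm R : x y / x + y}.
Proof. by move=> [? ?] [? ?]. Qed.

Lemma cReM {R : realType} (z w : R[i]) : cRe (z * w) = cRe z * cRe w - cIm z * cIm w.
Proof. by case: z w => [? ?] [? ?]. Qed.

Lemma cImM {R : realType} (z w : R[i]) : cIm (z * w) = cRe z * cIm w + cIm z * cRe w.
Proof. by case: z w => [? ?] [? ?]. Qed.

Lemma cRe_conjc {R : realType} (z : R[i]) : cRe (conjc z) = cRe z.
Proof. by case: z. Qed.

Lemma cIm_conjc {R : realType} (z : R[i]) : cIm (conjc z) = - cIm z.
Proof. by case: z. Qed.

Lemma cRe_sum {R : realType} I (r : seq I) (F : I -> R[i]) :
  cRe (\sum_(i <- r) F i) = \sum_(i <- r) cRe (F i).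
Proof. by apply: big_morph => //; exact: cRe_additive. Qed.

Lemma cIm_sum {R : realType} I (r : seq I) (F : I -> R[i]) :
  cIm (\sum_(i <- r) F i) = \sum_(i <- r) cIm (F i).
Proof. by apply: big_morph => //; exact: cIm_additive. Qed.

Lemma complex_eq {R : realType} (z w : R[i]) : cRe z = cRe w -> cIm z = cIm w -> z = w.
Proof. by case: z w => [? ?] [? ?] /= -> ->. Qed.

Lemma inv_real_complex {R : realType} (p : R) : (Complex p 0)^-1 = Complex p^-1 0.
Proof.
have [->|p0] := eqVneq p 0; first by rewrite [in RHS]invr0; exact: invr0.
apply: (mulfI (_ : Complex p 0 != 0)).
  by apply/eqP => -[/eqP]; rewrite (negbTE p0).
rewrite mulfV; last by apply/eqP => -[/eqP]; rewrite (negbTE p0).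
by apply: complex_eq; rewrite ?cReM ?cImM/=; rewrite ?mulfV// ?mulr0 ?mul0r ?subr0 ?addr0.
Qed.

Lemma normr_cRe_le {R : realType} (z : R[i]) : `|cRe z| <= cmod z.
Proof. by rewrite -sqrtr_sqr ler_sqrt ?lerDl ?sqr_ge0// addr_ge0 ?sqr_ge0. Qed.

Lemma normr_cIm_le {R : realType} (z : R[i]) : `|cIm z| <= cmod z.
Proof. by rewrite -sqrtr_sqr ler_sqrt ?lerDr ?sqr_ge0// addr_ge0 ?sqr_ge0. Qed.

Lemma cmod_le_cRe_cIm {R : realType} (z : R[i]) : cmod z <= `|cRe z| + `|cIm z|.
Proof.
rewrite -[leRHS]ger0_norm ?addr_ge0// -sqrtr_sqr ler_sqrt ?sqr_ge0// sqrrD.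
rewrite !real_normK ?num_real// -addrA lerD2l lerDr mulrn_wge0// mulr_ge0//.
Qed.

Section complex_integral.
Context {d} {T : measurableType d} {R : realType}.
Variables (mu : {measure set T -> \bar R}) (D : set T).
Hypothesis mD : measurable D.

(** Componentwise like [inner], so that [inner D g h] unfolds to the [cintegral] of [g] times the
    conjugate of [h]. *)
Definition cintegral (h : T -> R[i]) : R[i] :=
  Complex (Rintegral mu D (fun x => cRe (h x)))
          (Rintegral mu D (fun x => cIm (h x))).

Definition cintegrable (h : T -> R[i]) : Prop :=
  mu.-integrable D (EFin \o (fun x => cRe (h x))) /\
  mu.-integrable D (EFin \o (fun x => cIm (h x))).

Lemma cintegrableZl z h : cintegrable h -> cintegrable (fun x => z * h x).
Proof.
move=> [rh ih]; split.
  apply: eq_integrable (integrableB mD (integrableZl mD (cRe z) rh)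
    (integrableZl mD (cIm z) ih)) => // x _.
  by rewrite /= cReM EFinB !EFinM.
apply: eq_integrable (integrableD mD (integrableZl mD (cRe z) ih)
    (integrableZl mD (cIm z) rh)) => // x _.
by rewrite /= cImM EFinD !EFinM.
Qed.

Lemma cintegralZl z h : cintegrable h ->
  cintegral (fun x => z * h x) = z * cintegral h.
Proof.
move=> [rh ih].
have rh' r : mu.-integrable D (EFin \o (fun x => r * cRe (h x))).
  exact: (integrableZl mD r rh).
have ih' r : mu.-integrable D (EFin \o (fun x => r * cIm (h x))).
  exact: (integrableZl mD r ih).
apply: complex_eq; rewrite ?cReM ?cImM /= -!RintegralZl//.
  rewrite -RintegralB//; apply: eq_Rintegral => x _; exact: cReM.
rewrite -RintegralD//; apply: eq_Rintegral => x _; exact: cImM.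
Qed.

(** Integrability and the value are proved together, since the induction on the value uses
    integrability of the tail. *)
Lemma cintegral_sum I (r : seq I) (h : I -> T -> R[i]) :
  (forall i, cintegrable (h i)) ->
  cintegrable (fun x => \sum_(i <- r) h i x) /\
  cintegral (fun x => \sum_(i <- r) h i x) = \sum_(i <- r) cintegral (h i).
Proof.
move=> ih; elim: r => [|i r [ir IH]].
  rewrite big_nil; split.
    by split; apply: eq_integrable (@integrable0 _ _ _ mu D) => // x _; rewrite /= big_nil.
  by apply: complex_eq; rewrite /= /Rintegral integral0_eq// => x _; rewrite big_nil.
have [[ri ii] [rr irr]] := (ih i, ir); split.
  split.
    apply: eq_integrable (integrableD mD ri rr) => // x _.
    by rewrite /= big_cons cRe_additive EFinD.
  apply: eq_integrable (integrableD mD ii irr) => // x _.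
  by rewrite /= big_cons cIm_additive EFinD.
rewrite big_cons -IH; apply: complex_eq.
  rewrite cRe_additive /= -RintegralD//.
  by apply: eq_Rintegral => x _; rewrite big_cons cRe_additive.
rewrite cIm_additive /= -RintegralD//.
by apply: eq_Rintegral => x _; rewrite big_cons cIm_additive.
Qed.

End complex_integral.

(** * The sampling model *)

Section sampling.
Context {R : realType} {d : nat} (D : set (Rd R d)) (a b : R)
  {dO : measure_display} {Omega : measurableType dO} (P : probability Omega R)
  (X : nat -> Omega -> Rd R d) (Z T : nat -> Omega -> R)
  (pX : Rd R d -> R) (pZ : probability R R).
Hypotheses (mD : measurable D) (mpX : measurable_fun D pX)
  (pX_ge0 : forall x, D x -> 0 <= pX x)
  (sampling : sampling_model D P X Z T pX pZ (a + b))
  (oppc_lt : - (a + b) < a + b).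

Let c := a + b.
Local Notation U := (uniform_prob oppc_lt).

Let mX i : measurable_fun setT (X i). Proof. by case: sampling. Qed.
Let mZ i : measurable_fun setT (Z i). Proof. by case: sampling. Qed.
Let mT i : measurable_fun setT (T i). Proof. by case: sampling. Qed.

Let X0 : {mfun Omega >-> Rd R d} := mfun_Sub (mem_set (mX 0)).

(** As the law of [X 0] this is a probability at once; its density, and hence the total mass 1 of
    [pX] on [D], is then read off from the model. *)
Let muX : probability (Rd R d) R := distribution P X0.

Let E : measurableType _ := (Rd R d * (R * measurableTypeR R))%type.

Let Q : probability E R := prod_probability muX (prod_probability pZ U).

Let V i w : E := (X i w, (Z i w, T i w)).

Let mV i : measurable_fun setT (V i).
Proof. exact: (measurable_fun_pair (mX i) (measurable_fun_pair (mZ i) (mT i))). Qed.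

(** These are the sets [A x (B x C)] on which the model states its product formula. *)
Let G : set (set E) :=
  rectangles (rectangles (measurable : set (set R))).

(** [pX] is controlled only on [D]; the extension by zero is measurable and nonnegative everywhere,
    as a density must be here. *)
Let pXD : Rd R d -> R := pX \_ D.

Let pXD_ge0 x : 0 <= pXD x.
Proof. by rewrite /pXD patchE; case: ifPn => // /set_mem/pX_ge0. Qed.

Let measurable_pXD : measurable_fun setT pXD.
Proof. exact/(measurable_restrictT _ mD). Qed.

Let integral_pXD A : (\int[lebRd R d]_(x in A `&` D) (pX x)%:E =
  density_measure (lebRd R d) pXD measurable_pXD pXD_ge0 A)%E.
Proof.
rewrite integral_mkcondr; apply: eq_integral => x _.
by rewrite !patchE /pXD patchE; case: ifP.
Qed.

Let muXE A : measurable A ->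
  muX A = (\int[lebRd R d]_(x in A `&` D) (pX x)%:E)%E.
Proof.
move=> mA; case: sampling => _ _ _ /(_ 1%N (fun=> A) (fun=> setT) (fun=> setT)).
move=> /(_ (fun=> mA) (fun=> measurableT) (fun=> measurableT)).
rewrite big_ord_recl big_ord0 mule1 integral_uniform_pdf1//.
rewrite mule1 [pZ _]probability_setT mule1 => <-.
rewrite /muX/= /distribution /pushforward; congr (P _).
apply/seteqP; split => w /=; first by move=> Aw [].
by move=> /(_ 0%N erefl)[[]].
Qed.

Lemma integral_sampling_density :
  (\int[lebRd R d]_(x in D) (pX x)%:E = 1)%E.
Proof. by rewrite -[D]setTI -muXE//; exact: probability_setT. Qed.

Let QE A B C : measurable A -> measurable B -> measurable C ->
  Q (A `*` (B `*` C)) = (muX A * (pZ B * U C))%E.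
Proof.
move=> mA mB mC; rewrite /Q [LHS]product_measure1E//; last exact: measurableX.
by rewrite [X in (_ * X)%E]product_measure1E.
Qed.

Let indep k (S : nat -> set E) : (forall i, G (S i)) ->
  P (\bigcap_(i in `I_k) (V i @^-1` S i)) = (\prod_(i < k) Q (S i))%E.
Proof.
move=> GS.
have /choice[A /choice[B /choice[C ABC]]] : forall i, exists A B C,
    [/\ measurable A, measurable B, measurable C & S i = A `*` (B `*` C)].
  move=> i; have [A mA [_ [B mB [C mC <-]] <-]] := GS i.
  by exists A, B, C.
have mA i : measurable (A i) by case: (ABC i).
have mB i : measurable (B i) by case: (ABC i).
have mC i : measurable (C i) by case: (ABC i).
have SE i : S i = A i `*` (B i `*` C i) by case: (ABC i).
case: sampling => _ _ _ /(_ k A B C mA mB mC) H.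
transitivity (\prod_(i < k)
  ((\int[lebRd R d]_(x in A i `&` D) (pX x)%:E) * pZ (B i) *
   (\int[@lebesgue_measure R]_(t in C i) (uniform_pdf (- (a + b)) (a + b) t)%:E)))%E.
  rewrite -H; congr (P _); apply: eq_bigcapr => i _.
  by rewrite SE; apply/seteqP; split => w /=; rewrite /preimage/setX/=; tauto.
apply: eq_bigr => i _; rewrite SE.
transitivity (muX (A i) * (pZ (B i) * U (C i)))%E; last first.
  exact: (esym (QE (A i) (B i) (C i) (mA i) (mB i) (mC i))).
by rewrite muXE// muleA.
Qed.

Let mG : G `<=` measurable.
Proof.
move=> _ [A mA [_ [B mB [C mC <-]] <-]].
by apply: measurableX => //; exact: measurableX.
Qed.

Let GT : G setT.
Proof.
exists setT => //; exists setT; last by rewrite setXTT.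
by exists setT => //; exists setT => //; rewrite setXTT.
Qed.

Let detG : determining R G.
Proof.
apply: determining_rectangles.
  by exists setT => //; exists setT => //; rewrite setXTT.
by apply: determining_rectangles => //; exact: determining_measurable.
Qed.

(** The common law of the samples gives no mass to the complement of [D] or to Lebesgue-null sets,
    and there are countably many samples. *)
Lemma sample_in_ae (N : set (Rd R d)) : measurable N -> lebRd R d N = 0%E ->
  {ae P, forall w, forall i, (D `\` N) (X i w)}.
Proof.
move=> mN N0; pose A := ~` (D `\` N).
have mA : measurable A by apply/measurableC/measurableD.
have A0 : muX A = 0%E.
  rewrite muXE//; apply: null_set_integral; first exact: measurableI.
    by apply/measurable_EFinP; apply: (measurable_funS mD _ mpX); exact: subIsetr.
  apply/eqP; rewrite eq_le measure_ge0 andbT -N0; apply: le_measure.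
  - by rewrite inE; exact: measurableI.
  - by rewrite inE.
  - by move=> x [ADN Dx]; apply: contrapT => Nx; exact: ADN.
have XA i : P (X i @^-1` A) = 0%E.
  (* The event for one index [i] is a joint event of the first [i + 1] samples, unconstrained before
     [i]; the vanishing last factor kills the whole product. *)
  pose S (j : nat) : set E := if j == i then A `*` setT else setT.
  have GS j : G (S j).
    rewrite /S; case: ifP => // _; exists A => //; exists setT => //.
    by exists setT => //; exists setT => //; rewrite setXTT.
  transitivity (P (\bigcap_(j in `I_i.+1) (V j @^-1` S j))).
    congr (P _); apply/seteqP; split => w /=.
      by move=> Aw j _; rewrite /S; case: eqP => // ->; split.
    by move=> /(_ i (leqnn _)); rewrite /S eqxx => -[].
  rewrite indep// big_ord_recr /= {2}/S eqxx -setXTT.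
  have -> : Q (A `*` (setT `*` setT)) = 0%E.
    by apply: etrans (QE A setT setT mA measurableT measurableT) _; rewrite A0 mul0e.
  by rewrite mule0.
have : P.-negligible (\bigcup_i (X i @^-1` A)).
  apply: negligible_bigcup => i; apply/negligibleP; last exact: XA.
  by rewrite -[X in measurable X]setTI; exact: mX.
apply: negligibleS => w /= H; apply: contrapT => nH; apply: H => i.
by apply: contrapT => Di; apply: nH; exists i.
Qed.

Hypotheses (b0 : 0 <= b) (meanZ : (\int[pZ]_x x%:E = 0)%E)
  (suppZ : pZ `[- b, b]%classic = 1%E).

(** Here [g n] stands for the real or imaginary part of the kernel. The factor [c] cancels the
    [1 / c] of the dithered mean, and the density turns the law of [X] into an integral over [D]. *)
Lemma one_bit_average_cvg_ae (g : nat -> Rd R d -> R) (F : Rd R d -> R)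
    (M : nat -> R) :
  (forall n, measurable_fun setT (g n)) -> (forall n, 0 <= M n) ->
  (forall n x, `|g n x| <= M n) ->
  measurable_fun setT F -> (forall x, - a <= F x <= a) ->
  (forall eps, 0 < eps ->
    (\sum_(1 <= n <oo) (expR (- (eps ^+ 2 * n%:R) / M n ^+ 2))%:E < +oo)%E) ->
  {ae P, forall w,
    (fun n => n%:R^-1 *
       (\sum_(i < n) c * (g n (X i w) * quantize (F (X i w) + Z i w) (T i w)))
       - Rintegral (lebRd R d) D (fun x => g n x * F x * pX x))
      @ \oo --> (0 : R)}.
Proof.
move=> mg M0 gM mF Fa sumM.
have c_gt0 : 0 < c by rewrite /c; move: oppc_lt; lra.
pose h n (v : E) :=
  g n v.1 * quantize (F v.1 + v.2.1) v.2.2.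
have mh n : measurable_fun setT (h n).
  apply: measurable_funM; first exact: measurableT_comp (mg n) measurable_fst.
  apply: measurable_quantize.
    apply: measurable_funD; first exact: measurableT_comp mF measurable_fst.
    exact: measurableT_comp measurable_fst measurable_snd.
  exact: measurableT_comp measurable_snd measurable_snd.
have hM n v : `|h n v| <= M n by rewrite /h normrM normr_quantize mulr1.
have Rh n : Rintegral Q setT (fun v => c * h n v)
    = Rintegral (lebRd R d) D (fun x => g n x * F x * pX x).
  rewrite RintegralZl//; last first.
    by apply: (bounded_integrable Q (h n) (M n)); [exact: mh|exact: hM].
  rewrite (Rintegral_quantize_prod a b pZ meanZ suppZ oppc_lt b0 muX
    (g n) F (M n))//.
  rewrite mulrC divfK ?gt_eqF// [RHS]Rintegral_mkcond /Rintegral; congr fine.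
  rewrite (eq_measure_integral
    (density_measure (lebRd R d) pXD measurable_pXD pXD_ge0)); last first.
    by move=> A mA _; exact: (etrans (muXE A mA) (integral_pXD A)).
  rewrite integral_density; last exact: measurable_funM.
  apply: eq_integral => x _; congr EFin; rewrite /pXD !patchE.
  by case: ifP => // _; rewrite mulr0.
have := empirical_mean_cvg_ae P V Q G mV mG GT detG indep
  (fun n v => c * h n v) (fun n => c * M n).
move=> /(_ _ _ _ _)/(filterS _) cvgQ; apply: cvgQ => //.
- by move=> w /=; under eq_fun do rewrite Rh.
- by move=> n; apply: measurable_funM.
- by move=> n _; rewrite mulr_ge0// ltW.
- by move=> n v _; rewrite normrM gtr0_norm// ler_pM2l.
(* The summands are bounded by [c * M n], hence summability is used at [eps / c]. *)
- move=> eps eps0; have := sumM (eps / c) (divr_gt0 eps0 c_gt0).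
  congr (_ < _)%E; apply: eq_eseriesr => n _; congr (expR _)%:E.
  by rewrite !exprMn exprVn !mulNr (invfM (c ^+ 2)); congr (- _); ring.
Qed.

End sampling.

(** * The estimator and its mean *)

Section cmeasurable.
Context {d} {T : measurableType d} {R : realType} (D : set T).

Definition cmeasurable (h : T -> R[i]) : Prop :=
  measurable_fun D (fun x => cRe (h x)) /\ measurable_fun D (fun x => cIm (h x)).

Lemma cmeasurable_cst z : cmeasurable (fun=> z).
Proof. by split; exact: measurable_cst. Qed.

Lemma cmeasurableM h k :
  cmeasurable h -> cmeasurable k -> cmeasurable (fun x => h x * k x).
Proof.
move=> [hr hi] [kr ki]; split.
  rewrite (_ : (fun x => _) =
    (fun x => cRe (h x) * cRe (k x) - cIm (h x) * cIm (k x))).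
    by apply: measurable_funB; apply: measurable_funM.
  by apply/funext => x; rewrite cReM.
rewrite (_ : (fun x => _) =
  (fun x => cRe (h x) * cIm (k x) + cIm (h x) * cRe (k x))).
  by apply: measurable_funD; apply: measurable_funM.
by apply/funext => x; rewrite cImM.
Qed.

Lemma cmeasurable_conjc h : cmeasurable h -> cmeasurable (fun x => conjc (h x)).
Proof.
move=> [hr hi]; split.
  by under eq_fun do rewrite cRe_conjc.
by under eq_fun do rewrite cIm_conjc; exact: measurableT_comp.
Qed.

Lemma cmeasurable_real (f : T -> R) :
  measurable_fun D f -> cmeasurable (fun x => Complex (f x) 0).
Proof. by move=> mf; split => //=; exact: measurable_cst. Qed.

Lemma cmeasurable_sum I (r : seq I) (h : I -> T -> R[i]) :
  (forall i, cmeasurable (h i)) -> cmeasurable (fun x => \sum_(i <- r) h i x).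
Proof.
move=> mh; split.
  by under eq_fun do rewrite cRe_sum; apply: measurable_sum => i; case: (mh i).
by under eq_fun do rewrite cIm_sum; apply: measurable_sum => i; case: (mh i).
Qed.

End cmeasurable.

Lemma cmod_sqr {R : realType} (z : R[i]) : cmod z ^+ 2 = cRe z ^+ 2 + cIm z ^+ 2.
Proof. by rewrite sqr_sqrtr// addr_ge0 ?sqr_ge0. Qed.

(** On a set of finite measure, [t <= 1 + t ^+ 2] dominates the product by
    [a * (1 + cmod (phi x) ^+ 2)]. *)
Lemma L2_cintegrableM {R : realType} {d : nat} (D : set (Rd R d))
    (f : Rd R d -> R) (phi : Rd R d -> R[i]) (a : R) :
  measurable D -> (lebRd R d D < +oo)%E -> 0 <= a ->
  inF D a f -> L2 D phi ->
  cintegrable (lebRd R d) D (fun x => toC f x * conjc (phi x)).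
Proof.
move=> mD Doo a0 [mf fa] [rphi iphi phi2].
have [rm im] : cmeasurable D (fun x => toC f x * conjc (phi x)).
  by apply: cmeasurableM; [exact: cmeasurable_real|exact: cmeasurable_conjc].
have iD (r : R) : (lebRd R d).-integrable D (EFin \o (fun=> r)).
  apply: measurable_bounded_integrable => //.
  exists `|r|; split; first exact: num_real.
  by move=> M /ltW rM x _ /=.
have i2 : (lebRd R d).-integrable D (EFin \o (fun x => cmod (phi x) ^+ 2)).
  apply/integrableP; split.
    apply/measurable_EFinP; under eq_fun do rewrite cmod_sqr.
    by apply: measurable_funD; exact: measurable_funX.
  by under eq_integral do rewrite /= ger0_norm ?sqr_ge0//.
have ib : (lebRd R d).-integrable D (EFin \o (fun x => a * (1 + cmod (phi x) ^+ 2))).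
  exact: (integrableZl mD a (integrableD mD (iD 1) i2)).
have le_cmod (t : R) x : D x -> `|t| <= cmod (phi x) ->
    `|f x * t| <= a * (1 + cmod (phi x) ^+ 2).
  move=> Dx tphi; rewrite normrM ler_pM//; first by rewrite ler_norml fa.
  apply: le_trans tphi _; have := sqr_ge0 (cmod (phi x) - 1); nra.
have bnd (t : Rd R d -> R) : (forall x, `|t x| <= cmod (phi x)) ->
    measurable_fun D (fun x => f x * t x) ->
    (lebRd R d).-integrable D (EFin \o (fun x => f x * t x)).
  move=> tphi mt; apply: le_integrable ib => //; first exact/measurable_EFinP.
  move=> x Dx /=; rewrite lee_fin [leRHS]ger0_norm.
    exact: le_cmod.
  by rewrite mulr_ge0// addr_ge0// sqr_ge0.
have rE x : cRe (toC f x * conjc (phi x)) = f x * cRe (phi x).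
  by rewrite cReM cRe_conjc /= mul0r subr0.
have iE x : cIm (toC f x * conjc (phi x)) = f x * - cIm (phi x).
  by rewrite cImM cIm_conjc /= mul0r addr0.
split.
  under eq_fun do rewrite rE; apply: bnd => [x|]; first exact: normr_cRe_le.
  by under eq_fun do rewrite -rE.
under eq_fun do rewrite iE; apply: bnd => [x|].
  by rewrite normrN; exact: normr_cIm_le.
by under eq_fun do rewrite -iE.
Qed.

Definition weighted_kernel {R : realType} {d : nat} (pX : Rd R d -> R)
    (phi : nat -> Rd R d -> R[i]) (x : Rd R d) (m : nat) (y : Rd R d) : R[i] :=
  \sum_(j < m) phi j x * conjc (phi j y) / Complex (pX y) 0.

(** Exchanging the sums over basis functions and samples leaves a real scalar times the kernel in
    each term, so each component of the estimator is a real empirical mean. *)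
Lemma f_hatE {R : realType} {d : nat} {dO} {Omega : measurableType dO}
    (X : nat -> Omega -> Rd R d) (Z T : nat -> Omega -> R) (pX : Rd R d -> R)
    (phi : nat -> Rd R d -> R[i]) (c : R) (f : Rd R d -> R) (N m : nat)
    (x : Rd R d) (w : Omega) :
  f_hat X Z T pX phi c f N m x w = \sum_(i < N)
    Complex (c / N%:R * quantize (f (X i w) + Z i w) (T i w)) 0
    * weighted_kernel pX phi x m (X i w).
Proof.
have realM (r s : R) : Complex (r * s) 0 = Complex r 0 * Complex s 0 :> R[i].
  by apply: complex_eq; rewrite ?cReM ?cImM /= ?mulr0 ?mul0r ?subr0 ?addr0.
rewrite /f_hat /alpha_hat.
under eq_bigr do rewrite mulr_sumr mulr_suml.
rewrite exchange_big; apply: eq_bigr => i _ /=.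
rewrite /weighted_kernel mulr_sumr; apply: eq_bigr => j _.
rewrite (realM (c / N%:R)) /Bsign /quantize; ring.
Qed.

(** The factor [pX y] cancels the weight in the kernel. Keeping the scalar real lets real and
    imaginary parts pass through the integrand. *)
Lemma f_mE {R : realType} {d : nat} (D : set (Rd R d)) (pX : Rd R d -> R)
    (phi : nat -> Rd R d -> R[i]) (f : Rd R d -> R) (m : nat) (x : Rd R d) :
  measurable D -> (forall y, D y -> pX y != 0) ->
  (forall j, cintegrable (lebRd R d) D (fun y => toC f y * conjc (phi j y))) ->
  f_m D phi f m x = cintegral (lebRd R d) D
    (fun y => Complex (f y * pX y) 0 * weighted_kernel pX phi x m y).
Proof.
move=> mD p0 ih.
transitivity (\sum_(j < m) cintegral (lebRd R d) D
    (fun y => phi j x * (toC f y * conjc (phi j y)))).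
  apply: eq_bigr => j _; rewrite cintegralZl// mulrC.
  by congr (_ * _).
have [|_ <-] := @cintegral_sum _ _ _ (lebRd R d) D mD _ (index_enum 'I_m)
  (fun j y => phi (nat_of_ord j) x * (toC f y * conjc (phi j y))).
  by move=> j; exact: cintegrableZl.
have E y : y \in D -> \sum_(j < m) phi j x * (toC f y * conjc (phi j y))
    = Complex (f y * pX y) 0 * weighted_kernel pX phi x m y.
  move=> /set_mem/p0 py; rewrite /weighted_kernel mulr_sumr.
  apply: eq_bigr => j _; rewrite inv_real_complex.
  have -> : toC f y = Complex (f y * pX y) 0 * Complex (pX y)^-1 0.
    by apply: complex_eq; rewrite ?cReM ?cImM /= ?mulr0 ?mul0r ?subr0 ?addr0 ?mulfK.
  by ring.
by apply: complex_eq; apply: eq_Rintegral => y yD; rewrite E.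
Qed.

(** * Pointwise almost sure convergence of the estimator *)

Theorem theorem2 (R : realType) (d : nat) (D : set (Rd R d)) (a b : R)
  (dO : measure_display) (Omega : measurableType dO) (P : probability Omega R)
  (X : nat -> Omega -> Rd R d) (Z T : nat -> Omega -> R)
  (pX : Rd R d -> R) (pZ : probability R R) (nu : R)
  (phi : nat -> Rd R d -> R[i]) (Lambda : nat -> R) (mm : nat -> nat)
  (C1 C2 : R) :
  (0 < d)%N ->
  compactRd D ->
  0 < a -> 0 < b ->
  (* p_Z in P_Z : mean zero, support contained in [-b, b] *)
  (\int[pZ]_x x%:E = 0)%E ->
  pZ `[- b, b]%classic = 1%E ->
  (* p_X : density on D with inf_D p_X = nu > 0 *)
  measurable_fun D pX ->
  0 < nu -> (forall x, D x -> nu <= pX x) ->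
  (* the sampling model, with c = a + b *)
  sampling_model D P X Z T pX pZ (a + b) ->
  orthonormal_basis D phi ->
  (forall m, (0 < m)%N -> 0 <= Lambda m) ->
  (forall m k, (0 < m)%N -> (m <= k)%N -> Lambda m <= Lambda k) ->
  (forall n, (0 < n)%N -> (0 < mm n)%N) ->
  (forall n k, (0 < n)%N -> (n <= k)%N -> (mm n <= mm k)%N) ->
  0 < C1 -> 0 < C2 ->
  (* (1) *)
  {ae lebRd R d, forall x, D x ->
    {ae lebRd R d, forall y, D y ->
      forall m, (0 < m)%N ->
        cmod (\sum_(j < m) phi j x * conjc (phi j y) / Complex (pX y) 0)
          <= C1 * Lambda m}} ->
  (* (2) *)
  (forall f, inF D a f ->
    {ae lebRd R d, forall x, D x ->
      forall m, (0 < m)%N -> cmod (f_m D phi f m x) <= C2 * Lambda m}) ->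
  (* (3) *)
  (forall eps, 0 < eps ->
    (\sum_(1 <= n <oo) (expR (- (eps ^+ 2 * n%:R) / Lambda (mm n) ^+ 2))%:E
      < +oo)%E) ->
  (* conclusion: S_n(x) = fhat_{n,m(n)}(x) - f_{m(n)}(x) -> 0 a.s.,
     for a.e. x in D *)
  forall f, inF D a f ->
    {ae lebRd R d, forall x, D x ->
      {ae P, forall w,
        (fun n => cmod (f_hat X Z T pX phi (a + b) f n (mm n) x w
                        - f_m D phi f (mm n) x)) @ \oo --> (0 : R)}}.
Proof.
move=> _ cD a0 b0 meanZ suppZ mpX nu0 nupX sampling [phiL2 _ _] Lambda0 _ mm0 _.
move=> C10 _ kernel_bound _ sumLambda f fF; have [mf fa] := fF.
have mD := measurable_compactRd R d D cD.
have cc : - (a + b) < a + b by lra.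
have pX0 x : D x -> 0 < pX x by move=> Dx; exact: lt_le_trans (nupX x Dx).
have pX_ge0 x : D x -> 0 <= pX x by move/pX0/ltW.
have pX_neq0 x : D x -> pX x != 0 by move/pX0/gt_eqF/negbT.
(* Finiteness comes from the density: [nu] times the volume of [D] is at most the total mass of
   [pX], which is 1. *)
have Doo : (lebRd R d D < +oo)%E.
  have : (nu%:E * lebRd R d D <= 1)%E.
    rewrite -(integral_sampling_density D a b P X Z T pX pZ sampling cc).
    rewrite -integral_cst//; apply: ge0_le_integral => //.
    - by move=> x _; rewrite lee_fin ltW.
    - exact/measurable_EFinP.
  rewrite ltey; apply: contraTneq => ->.
  by rewrite gt0_muley ?lte_fin.
have ih j : cintegrable (lebRd R d) D (fun y => toC f y * conjc (phi j y)).
  exact: (L2_cintegrableM _ _ _ a mD Doo (ltW a0) fF (phiL2 j)).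
apply: filterS kernel_bound => x kernel_bound Dx.
have {kernel_bound}[N [mN N0 kN]] := kernel_bound Dx.
pose K := weighted_kernel pX phi x.
(* [Lambda 0] is unconstrained, but [K 0] vanishes. *)
pose L m := if m == 0%N then 0 else Lambda m.
have KL m y : (D `\` N) y -> cmod (K m y) <= C1 * L m.
  move=> [Dy Ny]; rewrite /L; case: m => [|m] /=.
    rewrite /K /weighted_kernel big_ord0 mulr0 /cmod /=.
    by rewrite expr0n/= addr0 sqrtr0.
  have : [set y | D y -> forall m, (0 < m)%N -> cmod (K m y) <= C1 * Lambda m] y.
    by apply: contrapT => ny; apply: Ny; exact: kN.
  exact.
have mK m : cmeasurable D (K m).
  apply: cmeasurable_sum => j; apply: cmeasurableM.
    apply: cmeasurableM; first exact: cmeasurable_cst.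
    by apply: cmeasurable_conjc; have [? ?] := phiL2 j.
  rewrite (_ : (fun y => _) = (fun y => Complex (pX y)^-1 0)); last first.
    by apply/funext => y; rewrite inv_real_complex.
  apply: cmeasurable_real.
  (* The inverse is traded for the measurable power function of exponent -1, equal to it on
     nonnegative values. *)
  apply: (eq_measurable_fun (fun y => powR (pX y) (-1))) => [y|].
    by move=> /set_mem Dy; rewrite powR_inv1// pX_ge0.
  exact: measurableT_comp (measurable_powR (-1)) mpX.
have inDN := sample_in_ae D a b P X Z T pX pZ mD mpX sampling cc N mN N0.
have mDN : measurable (D `\` N) by exact: measurableD.
pose F := f \_ D.
have mF : measurable_fun setT F by exact/(measurable_restrictT _ mD).
have Fa y : - a <= F y <= a.
  by rewrite /F patchE; case: ifPn => [/set_mem/fa//|_]; rewrite oppr_le0 ltW.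
pose M n := C1 * L (mm n).
have M0 n : 0 <= M n.
  by rewrite mulr_ge0 ?(ltW C10)// /L; case: eqVneq => // mn; rewrite Lambda0 ?lt0n.
have sumM eps : 0 < eps ->
    (\sum_(1 <= n <oo) (expR (- (eps ^+ 2 * n%:R) / M n ^+ 2))%:E < +oo)%E.
  (* The kernel bound carries the factor [C1], hence hypothesis (3) at [eps / C1]; at index 0 both
     exponents are zero. *)
  move=> eps0; have := sumLambda (eps / C1) (divr_gt0 eps0 C10).
  congr (_ < _)%E; apply: eq_eseriesr => -[_|n _].
    by rewrite !mulr0 !oppr0 !mul0r.
  rewrite /M /L gtn_eqF ?mm0//; congr (expR _)%:E.
  by rewrite !exprMn exprVn !mulNr (invfM (C1 ^+ 2)); congr (- _); ring.
(* One argument serves both components: it uses only that [part] is real-linear, dominated by the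
   modulus, measurable along the kernels and compatible with the integral. *)
have part_cvg (part : R[i] -> R) :
    (forall r z, part (Complex r 0 * z) = r * part z) ->
    {morph part : z w / z + w} ->
    (forall z, `|part z| <= cmod z) ->
    (forall m, measurable_fun D (fun y => part (K m y))) ->
    (forall h, part (cintegral (lebRd R d) D h)
      = Rintegral (lebRd R d) D (fun y => part (h y))) ->
  {ae P, forall w, (fun n => part (f_hat X Z T pX phi (a + b) f n (mm n) x w
    - f_m D phi f (mm n) x)) @ \oo --> (0 : R)}.
  move=> partZ partD part_le mpart part_int.
  have part0 : part 0 = 0 by have := partZ 0 0; rewrite mulr0 mul0r.
  have partB z w : part (z - w) = part z - part w.
    by apply/eqP; rewrite eq_sym subr_eq -partD subrK.
  (* Cutting the kernel off outside [D \ N] makes the bound hold everywhere; almost surely no sample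
     sees the change. *)
  pose g n := (fun y => part (K (mm n) y)) \_ (D `\` N).
  have mg n : measurable_fun setT (g n).
    apply/(measurable_restrictT _ mDN); apply: (measurable_funS mD _ (mpart (mm n))).
    exact: subDsetl.
  have gM n y : `|g n y| <= M n.
    rewrite /g patchE; case: ifPn => [/set_mem yDN|_]; last by rewrite normr0.
    exact: le_trans (part_le _) (KL (mm n) y yDN).
  have := one_bit_average_cvg_ae D a b P X Z T pX pZ mD mpX pX_ge0 sampling cc
    (ltW b0) meanZ suppZ g F M mg M0 gM mF Fa sumM.
  apply: filterS2 inDN => w wDN.
  under eq_fun => n.
    rewrite (_ : _ - _ = part (f_hat X Z T pX phi (a + b) f n (mm n) x w
      - f_m D phi f (mm n) x)); first over.
    rewrite partB; congr (_ - _).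
      rewrite f_hatE (big_morph part partD part0) mulr_sumr.
      apply: eq_bigr => i _; rewrite partZ /g /F !patchE !mem_set//.
        by rewrite -/(K (mm n) (X i w)); ring.
      exact: (wDN i).1.
    rewrite (f_mE D pX)// part_int /Rintegral; congr fine; apply: ae_eq_integral => //.
    - apply/measurable_EFinP; apply: measurable_funM => //.
      by apply: measurable_funTS; apply: measurable_funM.
    - apply/measurable_EFinP; under eq_fun do rewrite partZ.
      by apply: measurable_funM; [exact: measurable_funM|exact: mpart].
    (* Within [D] the integrands can differ only on the null set [N], where [g] was set to zero. *)
    - exists N; split => // y /= ny; apply: contrapT => Ny; apply: ny => Dy.
      rewrite partZ /g /F !patchE !mem_set//; congr EFin.
      by rewrite -/(K (mm n) y); ring.
  exact.
have re_cvg := part_cvg (@cRe R) _ (@cRe_additive R) normr_cRe_le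
  (fun m => (mK m).1) (fun=> erefl).
have im_cvg := part_cvg (@cIm R) _ (@cIm_additive R) normr_cIm_le
  (fun m => (mK m).2) (fun=> erefl).
apply: filterS2 (re_cvg _) (im_cvg _).
- move=> w /cvgr0Pnorm_lt re0 /cvgr0Pnorm_lt im0; apply/cvgr0Pnorm_lt => eps eps0.
  have eps2 : 0 < eps / 2 by rewrite divr_gt0.
  apply: filterS2 (re0 _ eps2) (im0 _ eps2) => n ren imn.
  rewrite ger0_norm ?sqrtr_ge0//; apply: le_lt_trans (cmod_le_cRe_cIm _) _.
  by rewrite [ltRHS]splitr ltrD.
- by move=> r z; rewrite cReM /= mul0r subr0.
- by move=> r z; rewrite cImM /= mul0r addr0.
Qed.
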